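(* For any $(r,q)$ lost sales system with constant lead time $\tau$, Poisson customer demand rate $\lambda$ (unit demands), and $x=\lambda\tau$, let $\gamma$ be the long run fraction of time with no on hand inventory. Then $$\frac{\mathrm{LOSS}(x,r)}{\mathrm{LOSS}(x,r)+q\left\lfloor \frac{r+q}{q}\right\rfloor}\;\le\;\gamma,\qquad\text{where}\quad \mathrm{LOSS}(x,r)=\sum_{k=r}^{\infty}(k-r)\frac{x^k}{k!}e^{-x}.$$ This is an equality when $r<q$.
   Context: The $(r,q)$ lost sales system (with integers $r\ge 0$, $q\ge 1$, and reals $\lambda>0$, $\tau>0$) is the following continuous-time stochastic inventory system. Customers arrive according to a Poisson process of rate $\lambda$, each demanding one unit. Let $l(t)\ge 0$ be the on hand inventory at epoch $t$, $u(t)$ the total number of units in outstanding replenishment orders (placed but not yet delivered), and $p(t)=l(t)+u(t)$ the inventory position. If a customer arrives when on hand inventory is positive, the demand is served immediately and on hand inventory decreases by one; if a customer arrives when on hand inventory is zero, the demand is lost (a lost sale) and the state does not change. Inventory is continuously reviewed: whenever serving a demand makes the inventory position drop to $r$, a replenishment order of $q$ units is placed immediately (so after ordering the inventory position lies in $\{r+1,\dots,r+q\}$). Each order is delivered exactly $\tau$ time units after it is placed, increasing on hand inventory by $q$. Several orders may be simultaneously outstanding. The quantity $\gamma$ is the long run time average of the indicator that $l(t)=0$. The quantity $x=\lambda\tau$ is the mean lead time demand. *)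

(* Defs.v *)
From mathcomp Require Export all_boot all_order all_algebra.
From mathcomp Require Export all_classical all_reals all_analysis.
From mathcomp Require Import finmap.

Set Implicit Arguments.
Unset Strict Implicit.
Unset Printing Implicit Defensive.

Import Order.TTheory GRing.Theory Num.Theory.
Import numFieldNormedType.Exports.

Local Open Scope classical_set_scope.
Local Open Scope ring_scope.

Definition mutually_independent (R : realType) (d : measure_display)
    (Omega : measurableType d) (P : probability Omega R)
    (X : nat -> {RV P >-> R}) : Prop :=
  forall (J : {fset nat}) (A : nat -> set R),
    (forall n, measurable (A n)) ->
    P (\bigcap_(n in [set` J]) (X n @^-1` A n)) =
    (\prod_(n <- J) P (X n @^-1` A n))%E.

(* A Poisson process of rate lambda on [0, +oo[, given by its interarrival
   times: X 0 is the epoch of the first arrival, X n.+1 the time between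
   arrivals number n and n.+1 (numbered from 0). *)
Definition poisson_interarrivals (R : realType) (d : measure_display)
    (Omega : measurableType d) (P : probability Omega R)
    (lambda : R) (X : nat -> {RV P >-> R}) : Prop :=
  mutually_independent X /\
  forall (n : nat) (A : set R), measurable A ->
    distribution P (X n) A = exponential_prob lambda A.

Definition arrival_epochs (R : realType) (d : measure_display)
    (Omega : measurableType d) (P : probability Omega R)
    (X : nat -> {RV P >-> R}) (w : Omega) (n : nat) : R :=
  \sum_(i < n.+1) X i w.

(* The set is almost surely finite; `fset_set` returns the empty set on an
   infinite one. *)
Definition arrivals_upto (R : realType) (a : nat -> R) (t : R) : nat :=
  #|` fset_set [set n | a n <= t]|.

(* `due` lists the delivery epochs of the outstanding orders, each of which is
   an order of q units. *)
Record inventory (R : realType) := Inventory { onhand : nat; due : seq R }.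

Definition outstanding (R : realType) (q : nat) (s : inventory R) : nat :=
  (q * size (due s))%N.

Definition position (R : realType) (q : nat) (s : inventory R) : nat :=
  (onhand s + outstanding q s)%N.

Definition deliver (R : realType) (q : nat) (t : R) (s : inventory R) :
    inventory R :=
  Inventory (onhand s + q * count (fun e : R => (e <= t)%R) (due s))%N
            [seq e <- due s | t < e].

Definition order_at (R : realType) (tau t : R) (s : inventory R) :
    inventory R :=
  Inventory (onhand s) (rcons (due s) (t + tau)).

Definition demand (R : realType) (r q : nat) (tau t : R) (s : inventory R) :
    inventory R :=
  if onhand s == 0%N then s else
  let s' := Inventory (onhand s).-1 (due s) in
  if position q s' == r then order_at tau t s' else s'.

(* State just after the first n arrivals. Deliveries due at an arrival epoch
   are credited before the demand; such a coincidence has probability zero. *)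
Fixpoint state_after (R : realType) (r q : nat) (tau : R) (s0 : inventory R)
    (a : nat -> R) (n : nat) : inventory R :=
  if n is m.+1 then
    demand r q tau (a m) (deliver q (a m) (state_after r q tau s0 a m))
  else s0.

Definition state_at (R : realType) (r q : nat) (tau : R) (s0 : inventory R)
    (a : nat -> R) (t : R) : inventory R :=
  deliver q t (state_after r q tau s0 a (arrivals_upto a t)).

(* The state at epoch 0 is any state of the system: orders already outstanding
   were placed at some epoch in ]-tau, 0]. *)
Definition admissible (R : realType) (r q : nat) (tau : R) (s0 : inventory R) :
    Prop :=
  (r < position q s0 <= r + q)%N /\
  forall e, e \in due s0 -> 0 < e <= tau.

Definition stockout_fraction (R : realType) (r q : nat) (tau : R)
    (s0 : inventory R) (a : nat -> R) (T : R) : R :=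
  T^-1 * \int[lebesgue_measure]_(t in `[0, T])
           \1_[set u : R | onhand (state_at r q tau s0 a u) = 0%N] t.

Definition long_run_stockout_fraction (R : realType) (d : measure_display)
    (Omega : measurableType d) (P : probability Omega R) (r q : nat) (tau : R)
    (s0 : inventory R) (X : nat -> {RV P >-> R}) (gamma : R) : Prop :=
  {ae P, forall w,
     stockout_fraction r q tau s0 (arrival_epochs X w) T @[T --> +oo] -->
       gamma}.

Definition LOSS (R : realType) (x : R) (r : nat) : R :=
  limn (fun n =>
    \sum_(r <= k < n) (k%:R - r%:R) * (x ^+ k / k`!%:R) * expR (- x)).

(* Main.v *)
(** Every order opens a lead-time window. At the moment the order is placed,
    the on hand inventory and the outstanding deliveries that arrive before it
    amount to at most r units, so a window containing D arrivals loses at least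
    D - r of them; an epoch lies in at most floor((r + q) / q) windows because
    the position never exceeds r + q. When r < q, all but the initially
    outstanding windows are disjoint and start with exactly r units on hand, and
    every lost sale falls in one of them, so both estimates are equalities.
    The demand in a window is Poisson of mean x and independent of the past, so
    it loses LOSS(x, r) sales on average. Since orders balance served demands,
    q * (order rate) = 1 - (loss rate), and the bound on the loss rate follows.

    The loss rate is gamma by a PASTA argument: given the past at an arrival,
    the mean time spent out of stock before the next arrival is 1 / lambda times
    the probability that the next demand is lost, because an exponential variable
    E satisfies E[min(E, c)] = P(E < c) / lambda. Only expectations of long run
    averages are needed, which the L^1 law of large numbers and dominated
    convergence provide. *)

From mathcomp Require Import finmap.
Require Import Defs.
From HB Require Import structures.
From mathcomp Require Import zify ring lra all_classical measurable_realfun.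
Import Order.TTheory GRing.Theory Num.Theory.
Import numFieldNormedType.Exports.
Local Open Scope classical_set_scope.
Local Open Scope ring_scope.

Set Implicit Arguments.
Unset Strict Implicit.
Unset Printing Implicit Defensive.

(** * Sample paths *)

(** A window may contain arbitrarily many arrivals. Its excess demand is therefore written as the
    number of [k >= r] such that at least [k + 1] arrivals fall in it, truncated at [k < K]. The
    sample path estimates become inequalities between finite sums of indicators, integrated term by
    term, and [LOSS] reappears as the sum over [k >= r] of the probabilities that a Poisson variable
    exceeds [k]: [k] arrivals within [tau] means that a sum of [k] interarrival times is below
    [tau].

    The long run fraction is given as an almost sure limit in real time, whereas losses are counted
    per arrival. Reading it along the arrival epochs requires an [L^1] comparison of the [n]-th
    epoch with [n / lambda], for which second moments suffice. Conditioning on the past is expressed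
    by Fubini's theorem for the joint law of a past variable and the next interarrival time.
    Increasing epochs are wanted on every path, but interarrival times are positive only almost
    surely, so they are finally modified on a null set. *)

Lemma sum_nat_shift (m K : nat) (F : nat -> nat) :
  (\sum_(m <= i < m + K) F i = \sum_(0 <= k < K) F (m + k))%N.
Proof.
rewrite -{1}[m]add0n big_addn addKn.
by apply: eq_bigr => k _; rewrite addnC.
Qed.

Section SamplePath.
Variables (R : realType) (r q : nat) (tau : R) (s0 : inventory R).
Variable a : nat -> R.
Hypotheses (hq : (0 < q)%N) (hs0 : admissible r q tau s0).

Local Notation st := (state_after r q tau s0 a).

Definition before_demand n := deliver q (a n) (st n).

Definition lost n : bool := onhand (before_demand n) == 0%N.

Definition ordered n : bool :=
  ~~ lost n && (position q (before_demand n) == r.+1).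

Lemma position_deliver t (s : inventory R) :
  position q (deliver q t s) = position q s.
Proof.
rewrite /position /outstanding /= -addnA -mulnDr size_filter.
rewrite -(count_predC (fun e => e <= t) (due s)); congr (_ + q * (_ + _))%N.
by apply: eq_count => e /=; rewrite ltNge.
Qed.

Lemma onhand_deliver_eq0 t (s : inventory R) :
  (onhand (deliver q t s) == 0%N) =
  (onhand s == 0%N) && all (fun e => t < e) (due s).
Proof.
rewrite /= addn_eq0 muln_eq0 (gtn_eqF hq) /=; congr andb.
rewrite -leqn0 leqNgt -has_count -all_predC.
by apply: eq_all => e /=; rewrite ltNge.
Qed.

Lemma demand_eq t (s : inventory R) :
  demand r q tau t s = Inventory (onhand s - (onhand s != 0%N))%N
    (if (onhand s != 0%N) && (position q s == r.+1)
     then rcons (due s) (t + tau) else due s).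
Proof.
case: s => -[|l] u //=; rewrite /demand /position /outstanding /= addSn eqSS.
by rewrite subn1; case: ifP.
Qed.

Lemma demandE n : st n.+1 =
  Inventory (onhand (before_demand n) - ~~ lost n)%N
    (if ordered n then rcons (due (before_demand n)) (a n + tau)
     else due (before_demand n)).
Proof. exact: demand_eq. Qed.

Lemma onhand_before n :
  onhand (before_demand n) = (onhand (st n.+1) + ~~ lost n)%N.
Proof. by rewrite demandE subnK// /lost; case: (onhand _). Qed.

Lemma position_step n :
  (position q (st n.+1) + ~~ lost n = position q (st n) + q * ordered n)%N.
Proof.
rewrite -(position_deliver (a n) (st n)) -/(before_demand n).
rewrite /position /outstanding onhand_before addnAC -[RHS]addnA -mulnDr.
congr (_ + q * _)%N; rewrite demandE [due _]/=.
by case: (ordered n); rewrite ?size_rcons ?addn1 ?addn0.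
Qed.

Lemma position_sum n :
  (position q (st n) + \sum_(i < n) ~~ lost i =
   position q s0 + q * \sum_(i < n) ordered i)%N.
Proof.
elim: n => [|n IH]; first by rewrite !big_ord0 muln0.
rewrite !big_ord_recr mulnDr [X in (_ + X)%N]addnC addnA position_step addnAC IH.
by rewrite addnA.
Qed.

Lemma position_bounds n : (r < position q (st n) <= r + q)%N.
Proof.
elim: n => [|n]; first by case: hs0.
have := position_step n; rewrite /ordered position_deliver.
move: (position q (st n.+1)) (position q (st n)) => p' p.
by case: (lost n) => /=; have [->|] := eqVneq p r.+1; lia.
Qed.

(** An order due after [T] is not removed by a delivery at an epoch [a i <= T], so it can be looked
    for among all orders ever placed. *)
Lemma count_due T n : (forall i, (i < n)%N -> a i <= T) ->
  count (fun e => T < e) (due (st n)) =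
  (count (fun e => T < e)%R (due s0)
   + \sum_(i < n) (ordered i && (T < a i + tau)%R))%N.
Proof.
elim: n => [|n IH] aT; first by rewrite big_ord0 addn0.
rewrite big_ord_recr addnA -IH; last by move=> i /ltnW; exact: aT.
rewrite demandE [due _]/=.
have -> : count (fun e => T < e) (due (st n)) =
          count (fun e => T < e) (due (before_demand n)).
  rewrite /= count_filter; apply: eq_count => e /=.
  by case: ltP => // /(le_lt_trans (aT n (ltnSn n))) ->.
by case: (ordered n); rewrite ?addn0// -cats1 count_cat /= addn0.
Qed.

(** The state contains a list of reals; here its stock is reduced to earlier [lost] and [ordered]
    flags and comparisons of epochs, from which measurability with respect to the past follows. No
    subtraction truncates. *)
Lemma onhand_deliver T n : (forall i, (i < n)%N -> a i <= T) ->
  onhand (deliver q T (st n)) =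
  (position q s0 + q * \sum_(i < n) ordered i - \sum_(i < n) ~~ lost i
   - q * (count (fun e => T < e)%R (due s0)
          + \sum_(i < n) (ordered i && (T < a i + tau)%R)))%N.
Proof.
move=> aT; rewrite -count_due// -position_sum addnK.
by rewrite -(position_deliver T) /position /outstanding/= size_filter addnK.
Qed.

Hypothesis a_homo : {homo a : i j / (i <= j)%N >-> i <= j}.

Lemma ordered_due_le j :
  (\sum_(n < j) (ordered n && (a j < a n + tau)%R) <= (r + q) %/ q)%N.
Proof.
rewrite leq_divRL// mulnC.
have /andP[_ /(leq_trans _)] := position_bounds j; apply.
rewrite (leq_trans _ (leq_addl _ _))// leq_mul2l; apply/orP; right.
rewrite (leq_trans _ (count_size (fun e => (a j < e)%R) _))// count_due ?leq_addl//.
by move=> i /ltnW; exact: a_homo.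
Qed.

(* The units that can serve demand before T. Between the order placed at a n and
   T = a n + tau this quantity decreases only by serving demand, because every
   order placed in the meantime is due at T or later. *)
Definition supply_before T (s : inventory R) :=
  (onhand s + q * count (fun e => (e < T)%R) (due s))%N.

Lemma supply_deliver T t s : t < T ->
  supply_before T (deliver q t s) = supply_before T s.
Proof.
move=> tT; rewrite /supply_before /= -addnA -mulnDr count_filter.
congr (_ + q * _)%N; elim: (due s) => //= e u <-.
case: (leP e t) => [et|te]; first by rewrite (le_lt_trans et tT) andbF; lia.
by rewrite andbT; lia.
Qed.

Lemma supply_demand T n : a n < T -> T <= a n + tau ->
  (supply_before T (st n.+1) + ~~ lost n = supply_before T (st n))%N.
Proof.
move=> anT Tan; rewrite -[RHS](@supply_deliver T (a n))// -/(before_demand n).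
rewrite /supply_before onhand_before addnAC; congr (_ + q * _)%N.
rewrite demandE /=; case: (ordered n) => //.
by rewrite -cats1 count_cat /= ltNge Tan !addn0.
Qed.

(** The position just after the order is [r + q], and the [q] units of this order arrive at
    [a n + tau] itself, hence not before it. *)
Lemma supply_ordered n :
  ordered n -> (supply_before (a n + tau)%R (st n.+1) <= r)%N.
Proof.
move=> on; have := position_step n; rewrite on muln1 => E.
have /andP[_ pb] := position_bounds n.+1.
move: (on) => /andP[ln /eqP pn]; move: E; rewrite ln.
move: pn; rewrite position_deliver => ->.
rewrite /position /supply_before /outstanding demandE on /=.
rewrite -cats1 count_cat size_cat /= ltxx !addn0 mulnDr muln1.
have := count_size (fun e => e < a n + tau) [seq e <- due (st n) | a n < e].
rewrite -(leq_pmul2l hq).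
move: (_ - _)%N (q * size _)%N (q * count _ _)%N => x y z; lia.
Qed.

Lemma lost_after_order n k : ordered n -> a (n + k)%N < a n + tau ->
  (k <= \sum_(i < k) lost (n.+1 + i) + r)%N.
Proof.
move=> on ak.
have E : (supply_before (a n + tau)%R (st (n.+1 + k)) +
    \sum_(i < k) ~~ lost (n.+1 + i) = supply_before (a n + tau)%R (st n.+1))%N.
  elim: k ak => [|k IH] ak; first by rewrite big_ord0 !addn0.
  rewrite big_ord_recr /= -IH; last first.
    by apply: le_lt_trans ak; apply: a_homo; rewrite leq_add2l.
  rewrite -(@supply_demand (a n + tau) (n.+1 + k)) -?addnS.
  - by rewrite addnA addnAC.
  - by rewrite addSnnS.
  - by rewrite lerD2r; apply: a_homo; lia.
have := supply_ordered on; rewrite -E.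
have : (\sum_(i < k) lost (n.+1 + i) + \sum_(i < k) ~~ lost (n.+1 + i) = k)%N.
  rewrite -big_split /= -[RHS](card_ord k) -sum1_card.
  by apply: eq_bigr => i _; case: lost.
lia.
Qed.

(** If [D] arrivals follow in the window, the left side is the positive part of [min(D, K) - r]. In
    this form every term has a Poisson tail as its probability. *)
Lemma demand_after_order_le n K : ordered n ->
  (\sum_(r <= k < K) (a (n.+1 + k)%N < a n + tau)%R <=
   \sum_(0 <= k < K) ((a (n.+1 + k)%N < a n + tau)%R && lost (n.+1 + k)))%N.
Proof.
move=> on; elim: K => [|K IH]; first by rewrite !big_geq.
have [rK|Kr] := leqP r K; last by rewrite big_geq.
rewrite !big_nat_recr//=.
(* Outside the window neither side grows. Inside it, all [K.+1] arrivals are in the window and the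
   loss bound applies directly, without the induction hypothesis. *)
have [aK|aK] := ltP (a (n.+1 + K)%N) (a n + tau); last by rewrite !addn0.
have ltK k : (k <= K)%N -> (a (n.+1 + k)%N < a n + tau) = true.
  by move=> kK; apply: le_lt_trans aK; apply: a_homo; rewrite leq_add2l.
rewrite (eq_big_nat _ _ (F2 := fun => 1%N)); last first.
  by move=> k /andP[_ /ltnW /ltK ->].
rewrite sum_nat_const_nat muln1.
have := @lost_after_order n K.+1 on; rewrite -addSnnS => /(_ aK).
rewrite big_ord_recr/= -(big_mkord xpredT (fun k => lost (n.+1 + k) : nat)).
have -> : (\sum_(0 <= k < K) lost (n.+1 + k) =
    \sum_(0 <= k < K) ((a (n.+1 + k)%N < a n + tau)%R && lost (n.+1 + k)))%N.
  by rewrite !big_nat; apply: eq_bigr => k /andP[_ kK]; rewrite ltK// ltnW.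
by move: (\sum_(0 <= k < K) _)%N => x; lia.
Qed.

(** Double counting of the pairs of an order [n] and a loss [j] in its window. For [n < N] and
    [k < K] the arrival [n.+1 + k] stays below [N + K]. *)
Lemma demand_over_orders_le N K :
  (\sum_(n < N) ordered n * \sum_(r <= k < K) (a (n.+1 + k)%N < a n + tau)%R <=
   (r + q) %/ q * \sum_(j < N + K) lost j)%N.
Proof.
apply: (@leq_trans (\sum_(n < N) \sum_(j < N + K)
    [&& (n < j)%N, ordered n, (a j < a n + tau)%R & lost j])%N).
  apply: leq_sum => n _; case on : (ordered n); last by rewrite mul0n.
  rewrite mul1n (leq_trans (demand_after_order_le K on))//.
  rewrite -(big_mkord xpredT (fun j => [&& (n < j)%N, true, (a j < a n + tau)%R & lost j] : nat)).
  rewrite [X in (_ <= X)%N](big_cat_nat (n := n.+1))//=; last first.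
    exact: leq_trans (ltn_ord n) (leq_addr _ _).
  rewrite (leq_trans _ (leq_addl _ _))//.
  rewrite [X in (_ <= X)%N](@big_cat_nat _ _ _ (n.+1 + K))//=; [|exact: leq_addr|by rewrite leq_add2r].
  rewrite (leq_trans _ (leq_addr _ _))//.
  by rewrite sum_nat_shift; apply: leq_sum => k _; case: ltnP => //; lia.
rewrite exchange_big /= big_distrr /=; apply: leq_sum => j _.
case lj : (lost j); last first.
  by rewrite big1// => n _; rewrite !andbF.
rewrite muln1; apply: leq_trans (ordered_due_le j).
rewrite -(big_mkord xpredT (fun n => [&& (n < j)%N, ordered n, (a j < a n + tau)%R & true] : nat)).
rewrite -(big_mkord xpredT (fun n => ordered n && (a j < a n + tau)%R : nat)).
have [jN|/ltnW Nj] := leqP j N.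
  rewrite (big_cat_nat (n := j))//= [X in (_ + X <= _)%N]big_nat_cond.
  rewrite [X in (_ + X <= _)%N]big1 ?addn0; last first.
    by move=> n /andP[/andP[jn _] _]; rewrite ltnNge jn.
  by apply: leq_sum => n _; rewrite andbT; case: (_ < _)%N.
rewrite [X in (_ <= X)%N](big_cat_nat (n := N))//= (leq_trans _ (leq_addr _ _))//.
by rewrite !big_nat; apply: leq_sum => n /andP[_ nN]; rewrite andbT; case: (_ < _)%N.
Qed.

Lemma onhand_le_before n i :
  (onhand (st n) <= onhand (before_demand (n + i)) + i)%N.
Proof.
elim: i => [|i IH]; first by rewrite !addn0 leq_addr.
rewrite (leq_trans IH)// onhand_before !addnS -[X in (_ <= X)%N]addSn.
rewrite leq_add2r -[X in (_ <= X)%N]addn1 leq_add ?leq_b1//.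
by rewrite /before_demand /= leq_addr.
Qed.

(** The position is positive, so an empty shelf means an outstanding order: an initial one, due by
    [tau], or one placed at an arrival [n < j]. In the latter case the [r] units on hand after that
    order were sold in between, which takes [r] arrivals strictly between [n] and [j]. *)
Lemma lost_le j : (r < q)%N ->
  (lost j <= (a j < tau)%R +
     \sum_(n < j) [&& ordered n, r + n < j & (a j < a n + tau)%R])%N.
Proof.
move=> rq; case lj : (lost j) => //.
have aj i : (i < j)%N -> a i <= a j by move=> /ltnW; exact: a_homo.
have : (0 < count (fun e => (a j < e)%R) (due (st j)))%N.
  rewrite -size_filter; have := position_bounds j.
  rewrite -(position_deliver (a j)) -/(before_demand j) /position /outstanding.
  move: lj; rewrite /lost => /eqP -> /=.
  by case: (size _) => //; rewrite muln0.
rewrite count_due//.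
have [atau|atau] := ltP (a j) tau; first by [].
rewrite (_ : count _ _ = 0%N); last first.
  apply/eqP; rewrite -leqn0 leqNgt -has_count; apply/negP => /hasP[e es aje].
  by case: hs0 => _ /(_ e es) /andP[_ /(lt_le_trans aje)]; rewrite ltNge atau.
rewrite !add0n => /leq_trans; apply; apply: leq_sum => n _.
case on : (ordered n) => //=; case: (a j < _) => //; rewrite ?andbT ?andbF //.
rewrite lt0b ltnNge; apply/negP => jr.
have nj := ltn_ord n.
(* The position before the ordering demand is [r.+1 <= q], and all of it is on hand: beside the unit
   being sold, one outstanding order would make it exceed [q]. *)
have sr : onhand (st n.+1) = r.
  move: on => /andP[ln /eqP pn].
  have := onhand_before n; rewrite ln addn1.
  move: pn; rewrite /position /outstanding.
  case: (size _) => [|k]; first by rewrite muln0 addn0 => -> [].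
  move: ln; rewrite /lost mulnS; case: (onhand _) => // l _; lia.
have := onhand_le_before n.+1 (j - n.+1); rewrite subnKC//.
by move: lj; rewrite /lost sr => /eqP ->; lia.
Qed.

(** With [j = n.+1 + k] the condition [r + n < j] becomes [r <= k]. The first sum covers the losses
    that initial orders may account for; its mean stays bounded, so it disappears from the rates. *)
Lemma sum_lost_le N : (r < q)%N ->
  (\sum_(j < N) lost j <= \sum_(j < N) (a j < tau)%R +
   \sum_(n < N) ordered n * \sum_(r <= k < N) (a (n.+1 + k)%N < a n + tau)%R)%N.
Proof.
move=> rq; apply: (@leq_trans (\sum_(j < N) ((a j < tau)%R +
     \sum_(n < j) [&& ordered n, r + n < j & (a j < a n + tau)%R]))%N).
  by apply: leq_sum => j _; exact: lost_le.
rewrite big_split leq_add2l /=.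
apply: (@leq_trans (\sum_(j < N) \sum_(n < N)
    [&& ordered n, r + n < j & (a j < a n + tau)%R])%N).
  apply: leq_sum => j _.
  rewrite -!(big_mkord xpredT (fun n => [&& ordered n, (r + n < j)%N & (a j < a n + tau)%R] : nat)).
  by rewrite [X in (_ <= X)%N](big_cat_nat (n := j))//= ?leq_addr// ltnW.
rewrite exchange_big /=; apply: leq_sum => n _.
case: (ordered n); last by rewrite mul0n big1.
rewrite mul1n /=.
rewrite -(big_mkord xpredT (fun j => (r + n < j)%N && (a j < a n + tau)%R : nat)).
(* The range is enlarged so that the shift by [n.+1] leaves exactly [k < N]. *)
apply: (@leq_trans (\sum_(0 <= j < n.+1 + N)
    ((r + n < j) && (a j < a n + tau)%R))%N).
  by rewrite [X in (_ <= X)%N](big_cat_nat (n := N))//= ?leq_addr ?leq_addl.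
rewrite (big_cat_nat (n := n.+1))//= ?leq_addr//.
rewrite big_nat_cond big1 ?add0n; last first.
  by move=> j /andP[/andP[_ jn] _]; case: ltnP => //; lia.
rewrite sum_nat_shift.
have [Nr|/ltnW rN] := leqP N r.
  by rewrite big_nat_cond big1// => k /andP[/andP[_ kN] _]; case: ltnP => //; lia.
rewrite (big_cat_nat (n := r))//= big_nat_cond big1 ?add0n; last first.
  by move=> k /andP[/andP[_ kr] _]; case: ltnP => //; lia.
rewrite !big_nat; apply: leq_sum => k _.
by case: (_ < _)%N.
Qed.

End SamplePath.

(** * Independence of an interarrival time and the past *)

Section Past.
Context (R : realType) (d : measure_display) (Omega : measurableType d)
  (P : probability Omega R).
Variable X : nat -> {RV P >-> R}.

(** A family closed under intersection that generates the sigma-algebra of [X 0], ..., [X n.-1].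
    Arrival [n] occurs at the sum of [X 0], ..., [X n], so it belongs to the past of index
    [n.+1]. *)
Definition cylinders (n : nat) : set (set Omega) :=
  [set \bigcap_(i in `I_n) X i @^-1` A i |
     A in [set A : nat -> set R | forall i, measurable (A i)]].

Definition pastType (n : nat) := g_sigma_algebraType (cylinders n).

Definition past (n : nat) (A : set Omega) : Prop :=
  measurable (A : set (pastType n)).

Lemma cylinders_measurable n : cylinders n `<=` measurable.
Proof.
move=> _ [A mA <-]; apply: bigcap_measurableType => i _.
exact: measurable_sfunP.
Qed.

Lemma past_measurable n A : past n A -> measurable A.
Proof.
by move: A; apply: smallest_sub; [exact: sigma_algebra_measurable|
  exact: cylinders_measurable].
Qed.

Lemma past_measurable_fun n d' (T : measurableType d') (f : Omega -> T) :
  @measurable_fun _ _ (pastType n) T setT f -> measurable_fun setT f.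
Proof.
by move=> pf _ B mB; apply: (@past_measurable n); exact: pf.
Qed.

Lemma cylinders_le m n : (m <= n)%N -> cylinders m `<=` cylinders n.
Proof.
move=> mn _ [A mA <-].
exists (fun i => if (i < m)%N then A i else setT) => [i|].
  by case: ifP.
apply/seteqP; split => w /= wA i /= im.
  by have := wA i (leq_trans im mn); rewrite im.
by case: ifP => // im'; exact: wA.
Qed.

Lemma past_le m n : (m <= n)%N -> past m `<=` past n.
Proof. by move=> mn; apply: sub_sigma_algebra2; exact: cylinders_le. Qed.

Lemma past_interarrival n i (B : set R) :
  (i < n)%N -> measurable B -> past n (X i @^-1` B).
Proof.
move=> ni mB; apply: sub_sigma_algebra.
exists (fun j => if j == i then B else setT) => [j|]; first by case: ifP.
apply/seteqP; split => w /= wA.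
  by have := wA i ni; rewrite eqxx.
by move=> j _; case: ifP => // /eqP ->.
Qed.

Lemma cylinders_setI n : setI_closed (cylinders n).
Proof.
move=> _ _ [A mA <-] [B mB <-]; exists (fun i => A i `&` B i) => [i|].
  exact: measurableI.
rewrite -bigcapI; apply: eq_bigcapr => i _; exact: preimage_setI.
Qed.

Hypothesis indepX : mutually_independent X.

Lemma prob_cylinder (A : nat -> set R) n :
  (forall i, measurable (A i)) ->
  P (\bigcap_(i in `I_n) X i @^-1` A i) =
  (\prod_(0 <= i < n) P (X i @^-1` A i))%E.
Proof.
move=> mA; have := @indepX [fset i | i in iota 0 n]%fset A mA.
have -> : [set` [fset i | i in iota 0 n]%fset] = `I_n.
  by apply/seteqP; split => i /=; rewrite in_fset /= mem_iota add0n.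
move=> ->; rewrite /index_iota subn0; apply: perm_big.
apply: uniq_perm; rewrite ?fset_uniq ?iota_uniq// => i.
by rewrite in_fset.
Qed.

(** As functions of [A], both sides are finite measures; they agree on the cylinders, hence on the
    sigma-algebra generated by them. *)
Lemma past_independent n A (B : set R) : past n A -> measurable B ->
  P (A `&` X n @^-1` B) = (P A * P (X n @^-1` B))%E.
Proof.
move=> pA mB.
have mXB : measurable (X n @^-1` B) by exact: measurable_sfunP.
pose c := NngNum (fine_ge0 (measure_ge0 P (X n @^-1` B))).
transitivity (mrestr P mXB A); first by [].
rewrite muleC -[X in (X * _)%E]fineK ?fin_num_measure//.
transitivity (mscale c P A); last by [].
move: A pA; apply: (g_sigma_algebra_measure_unique _ _ (fun _ => setT)).
- exact: cylinders_measurable.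
- move=> _; exists (fun _ => setT) => //.
  by apply/seteqP; split.
- by rewrite bigcup_const.
- exact: cylinders_setI.
- move=> _ [A mA <-].
  suff : P (\bigcap_(i in `I_n) X i @^-1` A i `&` X n @^-1` B) =
         (P (X n @^-1` B) * P (\bigcap_(i in `I_n) X i @^-1` A i))%E.
    move=> E; transitivity (P (\bigcap_(i in `I_n) X i @^-1` A i `&` X n @^-1` B)).
      by [].
    rewrite E -[X in (X * _)%E = _]fineK ?fin_num_measure//.
  (* [B] is appended as factor number [n], which turns the intersection into a cylinder of length
     [n.+1]. *)
  pose A' i := if i == n then B else A i.
  have mA' i : measurable (A' i) by rewrite /A'; case: ifP.
  have -> : \bigcap_(i in `I_n) X i @^-1` A i `&` X n @^-1` B =
            \bigcap_(i in `I_n.+1) X i @^-1` A' i.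
    apply/seteqP; split => w /= => [[wA wB] i /=|wA].
      by rewrite /A' ltnS leq_eqVlt; case: eqP => [->//|_] /= /wA.
    split=> [i /= ni|]; last by have := wA n (ltnSn n); rewrite /A' eqxx.
    by have := wA i (ltnW ni); rewrite /A' ltn_eqF.
  rewrite !prob_cylinder// big_nat_recr//= /A' eqxx muleC; congr (_ * _)%E.
  by apply: eq_big_nat => i /andP[_ ni]; rewrite ltn_eqF.
- by move=> _; rewrite -ge0_fin_numE ?fin_num_measure.
Qed.

Notation GR := (measurableTypeR R).

Lemma interarrival_measurable n :
  measurable_fun setT (X n : Omega -> GR).
Proof. by move=> _ B mB; exact: (measurable_funPT (X n)). Qed.

Definition interarrival n : {mfun Omega >-> GR} :=
  HB.pack (X n : Omega -> GR)
    (isMeasurableFun.Build _ _ _ _ _ (interarrival_measurable n)).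

Section PastFubini.
Context (n : nat) d' (T : measurableType d') (Y : Omega -> T) (h : T * GR -> \bar R).
Hypotheses (pY : @measurable_fun _ _ (pastType n) T setT Y)
  (mh : measurable_fun setT h) (h0 : forall z, (0 <= h z)%E).

Let Ym : {mfun Omega >-> T} := HB.pack Y
  (isMeasurableFun.Build _ _ _ _ _ (past_measurable_fun pY)).

(** The joint law of [Y] and [X n] is the product of their laws, since by independence the two agree
    on rectangles. *)
Let law_past_fubini : (\int[P]_w h (Y w, X n w) =
  \int[distribution P Ym \x distribution P (interarrival n)]_z h z)%E.
Proof.
have mYX : measurable_fun setT (fun w => (Ym w, interarrival n w)).
  by apply: measurable_fun_pair; exact: measurable_funPT.
pose YX : {mfun Omega >-> (T * GR)%type} := HB.pack (fun w => (Ym w, interarrival n w))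
  (isMeasurableFun.Build _ _ _ _ _ mYX).
rewrite -(ge0_integral_distribution YX mh h0).
apply: eq_measure_integral => A mA _.
apply/esym/product_measure_unique => //.
move=> A1 A2 mA1 mA2; rewrite /distribution /pushforward /= -past_independent//.
by rewrite /past -[X in measurable X]setTI; exact: (pY measurableT mA1).
Qed.

(** This plays the part of conditioning on the past: [X n] is integrated against its law while [Y]
    is frozen. *)
Lemma past_fubini :
  (\int[P]_w h (Y w, X n w) =
   \int[P]_w \int[distribution P (interarrival n)]_v h (Y w, v))%E.
Proof.
rewrite law_past_fubini (fubini_tonelli1 h mh h0).
apply: (ge0_integral_distribution Ym); last by move=> y; apply: integral_ge0.
exact: measurable_fun_fubini_tonelli_F.
Qed.

Lemma past_fubini_swap :
  (\int[P]_w h (Y w, X n w) =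
   \int[distribution P (interarrival n)]_v \int[P]_w h (Y w, v))%E.
Proof.
rewrite law_past_fubini (fubini_tonelli2 h mh h0); apply: eq_integral => v _.
apply: (ge0_integral_distribution Ym (f := fun y => h (y, v))) => [|//].
exact: measurableT_comp mh (measurable_pair2 v).
Qed.

End PastFubini.

End Past.

(** * The exponential law *)

Section Density.
Import HBNNSimple.
Local Open Scope ereal_scope.

(** Indicators by the hypothesis on [nu], simple functions by linearity, the general case by
    monotone convergence. *)
Lemma integral_density d (T : measurableType d) (R : realType)
    (mu nu : {measure set T -> \bar R}) (p : T -> R) (f : T -> \bar R) :
  measurable_fun setT p -> (forall x, 0 <= p x)%R ->
  (forall A, measurable A -> nu A = \int[mu]_(x in A) (p x)%:E) ->
  measurable_fun setT f -> (forall x, 0 <= f x) ->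
  \int[nu]_x f x = \int[mu]_x (f x * (p x)%:E).
Proof.
move=> mp p0 nuE mf f0.
pose h := nnsfun_approx measurableT mf.
have hf x : f x = lim ((EFin \o h n) x @[n --> \oo]).
  by apply/esym/cvg_lim => //; exact: cvg_nnsfun_approx.
have hM x : f x * (p x)%:E = lim ((EFin \o h n) x * (p x)%:E @[n --> \oo]).
  by apply/esym/cvg_lim => //; apply: cvgeZr => //; exact: cvg_nnsfun_approx.
under eq_integral do rewrite hf.
rewrite monotone_convergence//; last 3 first.
- by move=> n; exact/measurable_EFinP.
- by move=> n x _; rewrite lee_fin.
- by move=> x _ a b ab; rewrite lee_fin; exact/lefP/nd_nnsfun_approx.
under [RHS]eq_integral do rewrite hM.
rewrite monotone_convergence//; last 3 first.
- by move=> n; apply: emeasurable_funM; exact/measurable_EFinP.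
- by move=> n x _; rewrite mule_ge0 ?lee_fin.
- move=> x _ a b ab; rewrite lee_wpmul2r ?lee_fin//.
  exact/lefP/nd_nnsfun_approx.
apply: congr_lim; apply/funext => n /=.
under eq_integral do rewrite fimfunE -fsumEFin//.
rewrite ge0_integral_fsum//; last 2 first.
- by move=> r; exact/measurable_EFinP/measurable_funM.
- by move=> r x _; exact: nnfun_muleindic_ge0.
under [RHS]eq_integral => x _.
  rewrite fimfunE -fsumEFin// ge0_mule_fsuml; last first.
    by move=> r; exact: nnfun_muleindic_ge0.
  over.
rewrite ge0_integral_fsum//; last 2 first.
- move=> r; apply: emeasurable_funM; last exact/measurable_EFinP.
  exact/measurable_EFinP/measurable_funM.
- by move=> r x _; rewrite mule_ge0 ?lee_fin//; exact: nnfun_muleindic_ge0.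
apply: eq_fsbigr => r rhn; move: rhn; rewrite inE => -[t _ <-].
under eq_integral do rewrite EFinM.
under [RHS]eq_integral do rewrite EFinM -muleA.
rewrite integralZl_indic_nnsfun// ge0_integralZl//; last 3 first.
- by apply: emeasurable_funM; exact/measurable_EFinP.
- by move=> x _; rewrite mule_ge0 ?lee_fin.
- by rewrite lee_fin.
rewrite integral_indic// setIT nuE//; congr (_ * _).
rewrite [LHS]integral_mkcond; apply: eq_integral => x _.
by rewrite epatch_indic muleC.
Qed.

End Density.

Section ExponentialLaw.
Context (R : realType) (lambda : R) (lambda_gt0 : 0 < lambda).
Notation GR := (measurableTypeR R).
Variable nu : probability GR R.
Hypothesis nuE : forall A, measurable A -> nu A = exponential_prob lambda A.

Notation mu := lebesgue_measure.
Notation pdf := (exponential_pdf lambda).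

Lemma integral_exponential (f : GR -> \bar R) :
  measurable_fun setT f -> (forall x, 0 <= f x)%E ->
  (\int[nu]_x f x = \int[mu]_x (f x * (pdf x)%:E))%E.
Proof.
move=> mf f0; apply: integral_density => //.
- exact: measurable_exponential_pdf.
- by move=> x; exact/exponential_pdf_ge0/ltW.
Qed.

Lemma exponential_tail (u : R) : 0 <= u ->
  nu `]u, +oo[%classic = (expR (- lambda * u))%:E.
Proof.
move=> u0; rewrite nuE//.
have cE : continuous (fun z : R^o => expR (- lambda * z)).
  move=> z; apply: continuous_comp; last exact: continuous_expR.
  by apply: continuousM => //; apply: (@continuousN _ R^o); exact: cst_continuous.
rewrite /exponential_prob integral_itv_obnd_cbnd; last first.
  apply/measurable_funTS/measurable_EFinP; exact: measurable_exponential_pdf.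
rewrite (@ge0_continuous_FTC2y _ _ (fun x => - (expR (- lambda * x))) _ 0)//.
- by rewrite EFinN oppeK add0e.
- by move=> x _; apply: exponential_pdf_ge0; exact: ltW.
- apply: (@continuous_subspaceW R^o _ _ [set` `[0, +oo[%R]).
    by apply: subset_itvr; rewrite bnd_simp.
  exact: within_continuous_exponential_pdf.
- rewrite -oppr0; apply: cvgN.
  rewrite (_ : (fun x => expR (- lambda * x)) =
               (fun z => expR (- z)) \o (fun z => lambda * z)); last first.
    by apply: eq_fun => x; rewrite mulNr.
  apply: (@cvg_comp _ _ _ _ _ _ (pinfty_nbhs R)); last exact: cvgr_expR.
  exact: gt0_cvgMry.
- by apply: cvgN; apply/cvg_at_right_filter; exact: cE.
- move=> z; rewrite in_itv/= andbT => uz; apply: derive1_exponential_pdf.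
  by rewrite in_itv/= andbT (le_lt_trans u0).
Qed.

Lemma exponential_le0 : nu `]-oo, 0]%classic = 0%E.
Proof.
have : (nu (`]-oo, 0%R]%classic `|` `]0%R, +oo[%classic) =
    nu `]-oo, 0%R]%classic + nu `]0%R, +oo[%classic)%E.
  apply: measureU => //; apply/seteqP; split => x //=.
  by rewrite !in_itv/= andbT => -[]; rewrite leNgt => /negP.
rewrite exponential_tail// mulr0 expR0 -itv_bndbnd_setU// set_itvNyy.
rewrite [nu setT]probability_setT.
by case: (nu `]-oo, 0]%classic) => // r [] /eqP; rewrite -subr_eq subrr => /eqP <-.
Qed.

Section IntegratedTail.
Variable g : GR -> \bar R.
Hypotheses (mg : measurable_fun setT g) (g0 : forall x, (0 <= g x)%E).

Let h (z : GR * GR) := (g z.2 * (\1_[set z : GR * GR | 0 <= z.2 < z.1] z)%:E)%E.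

Let mD : measurable [set z : GR * GR | 0 <= z.2 < z.1].
Proof.
rewrite -[X in measurable X]setTI; apply: measurable_and => //.
  by apply: measurable_fun_ler => //; exact: measurable_snd.
by apply: measurable_fun_ltr; [exact: measurable_snd|exact: measurable_fst].
Qed.

Let mh : measurable_fun setT h.
Proof.
apply: emeasurable_funM; first exact: measurableT_comp.
exact/measurable_EFinP/measurable_indic.
Qed.

Let h0 z : (0 <= h z)%E.
Proof. by rewrite mule_ge0 ?lee_fin. Qed.

Let integral0_h v : (\int[mu]_(u in `[0%R, v[) g u = \int[mu]_u h (v, u))%E.
Proof.
rewrite integral_mkcond; apply: eq_integral => u _.
rewrite patchE /h /= indicE; case: ifPn => [|/negP] uv.
  by rewrite mem_set ?mule1//; move: uv; rewrite inE /= in_itv.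
by rewrite memNset ?mule0// => uv'; apply: uv; rewrite inE /= in_itv.
Qed.

Lemma measurable_integral0 :
  measurable_fun setT (fun v : GR => \int[mu]_(u in `[0%R, v[) g u)%E.
Proof.
rewrite (_ : (fun v : GR => _) = (fun v => \int[mu]_u h (v, u))%E).
  exact: (@measurable_fun_fubini_tonelli_F _ _ _ _ _ mu h mh h0).
by apply/funext => v; exact: integral0_h.
Qed.

(** By Tonelli the left side integrates [g u] against the tail [expR (- lambda * u)] over [u >= 0],
    and this tail is the density divided by [lambda]. Taking for [g] the indicator of []-oo, c[],
    the constant 1 and the positive part gives the truncated mean, the mean and the second
    moment. *)
Lemma exponential_integrated_tail :
  (\int[nu]_v \int[mu]_(u in `[0%R, v[) g u = (lambda^-1)%:E * \int[nu]_v g v)%E.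
Proof.
under eq_integral do rewrite integral0_h.
rewrite (fubini_tonelli h mh h0) integral_exponential// -ge0_integralZl//; last 3 first.
- apply: emeasurable_funM => //; apply/measurable_EFinP.
  exact: measurable_exponential_pdf.
- by move=> x _; rewrite mule_ge0// lee_fin; exact/exponential_pdf_ge0/ltW.
- by rewrite lee_fin invr_ge0 ltW.
apply: eq_integral => u _; rewrite /h /=.
rewrite ge0_integralZl//; last first.
  apply/measurable_EFinP; apply: measurableT_comp (measurable_pair2 u).
  exact: measurable_indic.
have [u0|u0] := leP 0 u; last first.
  rewrite lt0_exponential_pdf// !mule0 integral0_eq ?mule0// => v _.
  by rewrite indicE memNset//= leNgt u0.
transitivity (g u * nu `]u, +oo[%classic)%E.
  congr (_ * _)%E; rewrite -[X in _ = nu X]setIT -integral_indic//.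
  apply: eq_integral => v _; rewrite !indicE; congr ((nat_of_bool _)%:R%:E).
  by apply/idP/idP; rewrite !inE /= in_itv/= u0 andbT.
rewrite exponential_tail// exponential_pdfE// muleCA; congr (_ * _)%E.
by rewrite -EFinM mulrA mulVf ?mul1r// gt_eqF.
Qed.

End IntegratedTail.

Lemma lebesgue_measure_0itv (v : R) :
  mu `[0%R, v[%classic = (Num.max 0 v)%:E.
Proof.
rewrite lebesgue_measure_itv/= lte_fin; case: ltP => v0; last by [].
by rewrite -EFinB subr0.
Qed.

(** The positive part makes the integrand the length of the part of [[0, v[] below [c], for all real
    [v] and [c]. *)
Lemma exponential_mean_min (c : R) :
  (\int[nu]_v (Num.max 0 (Num.min v c))%:E =
   (lambda^-1)%:E * nu `]-oo, c[%classic)%E.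
Proof.
have := @exponential_integrated_tail (EFin \o \1_`]-oo, c[%classic).
move=> /(_ _ _)/esym.
rewrite integral_indic// setIT => ->//; last 2 first.
- by apply/measurable_EFinP; exact: measurable_indic.
- by move=> x; rewrite lee_fin.
apply: eq_integral => v _; rewrite integral_indic//.
rewrite -lebesgue_measure_0itv; congr (mu _).
apply/seteqP; split => u /=; rewrite !in_itv/= lt_min.
  by move=> /and3P[-> -> ->].
by move=> [-> /andP[-> ->]].
Qed.

Lemma exponential_mean : (\int[nu]_v (Num.max 0 v)%:E = (lambda^-1)%:E)%E.
Proof.
have := @exponential_integrated_tail (cst 1%E).
rewrite [X in (_ * X)%E](_ : _ = 1%E); last first.
  by rewrite integral_cst// mul1e; exact: probability_setT.
rewrite mule1 => <-//.
by apply: eq_integral => v _; rewrite integral_cst// mul1e -lebesgue_measure_0itv.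
Qed.

(** The integral of the positive part over [[0, v[] is at least that of [v / 2] over [[v / 2, v[],
    which is [v ^+ 2 / 4]; its mean is at most [1 / lambda ^+ 2]. The crude constant 4 is enough for
    the law of large numbers. *)
Lemma exponential_moment2 :
  (\int[nu]_v ((Num.max 0 v) ^+ 2)%:E <= (4 / lambda ^+ 2)%:E)%E.
Proof.
have mmax : measurable_fun setT (fun v : GR => Num.max 0 v : R).
  by apply: measurable_maxr.
have := @exponential_integrated_tail (fun v => (Num.max 0 v)%:E).
rewrite exponential_mean -EFinM => E.
have {E} : (\int[nu]_v ((Num.max 0 v) ^+ 2 / 4)%:E <= (lambda^-1 / lambda)%:E)%E.
  rewrite -E//; [|exact/measurable_EFinP|by move=> v; rewrite lee_fin le_max lexx].
  apply: ge0_le_integral => //.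
  - by move=> v _; rewrite lee_fin divr_ge0// sqr_ge0.
  - apply/measurable_EFinP/measurable_funM => //; exact: measurable_funX.
  - apply: (measurable_integral0 (g := fun v => (Num.max 0 v)%:E)).
      exact/measurable_EFinP.
    by move=> v; rewrite lee_fin le_max lexx.
  move=> v _; have [v0|v0] := leP v 0.
    rewrite expr0n/= mul0r; apply: integral_ge0 => u _.
    by rewrite lee_fin le_max lexx.
  apply: (@le_trans _ _ (\int[mu]_(u in `[(v / 2)%R, v[) (v / 2)%:E)%E).
    rewrite integral_cst//= lebesgue_measure_itv/= lte_fin ifT; last lra.
    by rewrite -EFinB -EFinM lee_fin; lra.
  apply: (@le_trans _ _ (\int[mu]_(u in `[(v / 2)%R, v[) (Num.max 0 u)%:E)%E).
    apply: ge0_le_integral => //.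
    - by move=> u _; rewrite lee_fin; lra.
    - exact/measurable_funTS/measurable_EFinP.
    - by move=> u /=; rewrite in_itv/= lee_fin le_max => /andP[-> _]; rewrite orbT.
  apply: ge0_subset_integral => //.
  - exact/measurable_funTS/measurable_EFinP.
  - by move=> u _; rewrite lee_fin le_max lexx.
  - by move=> u /=; rewrite !in_itv/= => /andP[vu ->]; rewrite andbT; lra.
under eq_integral do rewrite mulrC EFinM.
rewrite ge0_integralZl//; last first.
- by move=> v _; rewrite lee_fin sqr_ge0.
- by apply/measurable_EFinP; exact: measurable_funX.
rewrite -[X in (X <= _)%E -> _]muleC -lee_pdivlMr//.
move=> /le_trans; apply; rewrite -EFinM lee_fin.
by rewrite [leRHS](_ : _ = lambda^-1 / lambda * 4^-1^-1)//; field; rewrite gt_eqF.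
Qed.

(* The distribution function of a sum of k independent interarrival times. *)
Definition erlang (k : nat) (t : R) : R :=
  if 0 < t then
    1 - expR (- lambda * t) * \sum_(j < k) (lambda * t) ^+ j / j`!%:R
  else 0.

Lemma exp_sum_le_expR (x : R) n : 0 <= x ->
  \sum_(j < n) x ^+ j / j`!%:R <= expR x.
Proof.
move=> x0; rewrite -(big_mkord xpredT (fun j => x ^+ j / j`!%:R)).
apply: (nondecreasing_cvgn_le _ (is_cvg_series_exp_coeff x) n).
apply: nondecreasing_series => k _ _; exact: exp_coeff_ge0.
Qed.

Lemma erlang_ge0 k t : 0 <= erlang k t.
Proof.
rewrite /erlang; case: ifPn => // t0.
rewrite subr_ge0 mulNr expRN mulrC ler_pdivrMr ?expR_gt0// mul1r.
by apply: exp_sum_le_expR; rewrite mulr_ge0 ?ltW.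
Qed.

Lemma measurable_erlang k : measurable_fun setT (erlang k).
Proof.
rewrite /erlang; apply: measurable_fun_ifT => //.
  exact: measurable_fun_ltr.
apply: measurable_funB => //; apply: measurable_funM.
  by apply: measurableT_comp => //; exact: measurable_funM.
apply: measurable_sum => j; apply: measurable_funM => //.
by apply: measurable_funX; exact: measurable_funM.
Qed.

(** An antiderivative in [v] of the density at [v] times the formula for [erlang k (t - v)]. It is
    elementary because [expR (- lambda * (t - v)) * expR (- lambda * v)] does not depend on [v]. *)
Let erlang_primitive (k : nat) (t v : R) : R :=
  expR (- lambda * t) * (\sum_(j < k) (lambda * (t - v)) ^+ j.+1 / j.+1`!%:R)
  - expR (- lambda * v).

Lemma is_derive_erlang_primitive k (t v : R) :
  is_derive v 1 (erlang_primitive k t) ((1 - expR (- lambda * (t - v)) *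
    \sum_(j < k) (lambda * (t - v)) ^+ j / j`!%:R) * (lambda * expR (- lambda * v))).
Proof.
have dX (j : nat) : is_derive v 1 (fun v => (lambda * (t - v)) ^+ j.+1 / j.+1`!%:R)
    (- lambda * ((lambda * (t - v)) ^+ j / j`!%:R)).
  have dl : is_derive v 1 (fun v => lambda * (t - v)) (- lambda).
    apply: (is_derive_eq (is_deriveM (is_derive_cst lambda v 1)
      (is_deriveB (is_derive_cst t v 1) (is_derive_id v 1)))).
    by rewrite scaler0 addr0 sub0r scalerN /GRing.scale/= mulr1.
  rewrite (_ : (fun _ => _) = j.+1`!%:R^-1 *:
      ((fun v => lambda * (t - v)) ^+ j.+1 : R -> R)); last first.
    by apply/funext => x; rewrite -[RHS]/(_ * _) exprfctE mulrC.
  apply: (is_derive_eq (is_deriveZ _ (is_deriveX j.+1 dl))).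
  rewrite /GRing.scale/= factS natrM; field.
  by rewrite nat1r !pnatr_eq0 -lt0n fact_gt0.
have dE : is_derive v 1 (fun v => expR (- lambda * v))
    (- lambda * expR (- lambda * v)).
  have dl : is_derive v 1 (fun v => - lambda * v) (- lambda).
    apply: (is_derive_eq (is_deriveM (is_derive_cst (- lambda) v 1) (is_derive_id v 1))).
    by rewrite scaler0 addr0 /GRing.scale/= mulr1.
  apply: (is_derive_eq (is_derive1_comp (is_derive_expR _) dl)).
  by rewrite mulrC.
rewrite (_ : erlang_primitive k t = expR (- lambda * t) *:
    (\sum_(j < k) (fun v => (lambda * (t - v)) ^+ j.+1 / j.+1`!%:R))
    - (fun v => expR (- lambda * v))); last first.
  by apply/funext => x; rewrite /erlang_primitive -[RHS]/(_ * _ - _) fct_sumE.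
apply: (is_derive_eq (is_deriveB (is_deriveZ _ (is_derive_sum (fun j => dX j))) dE)).
rewrite -mulr_sumr /GRing.scale/=.
have -> : expR (- lambda * t) = expR (- lambda * (t - v)) * expR (- lambda * v).
  by rewrite -expRD -mulrDr subrK.
by ring.
Qed.

Let erlang_integrand (k : nat) (t v : R) : R :=
  (1 - expR (- lambda * (t - v)) *
    \sum_(j < k) (lambda * (t - v)) ^+ j / j`!%:R) * (lambda * expR (- lambda * v)).

Lemma continuous_erlang_integrand k (t : R) : continuous (erlang_integrand k t).
Proof.
have cl (c : R) : continuous (fun v : R => c * v).
  by move=> v; apply: cvgM; [exact: cvg_cst|exact: cvg_id].
have ct (c : R) : continuous (fun v : R => c * (t - v)).
  move=> v; apply: cvgM; first exact: cvg_cst.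
  by apply: cvgB; [exact: cvg_cst|exact: cvg_id].
move=> v; apply: cvgM; last first.
  apply: cvgM; first exact: cvg_cst.
  by apply: (@continuous_comp _ _ _ _ expR); [exact: cl|exact: continuous_expR].
apply: cvgB; first exact: cvg_cst.
apply: cvgM.
  by apply: (@continuous_comp _ _ _ (fun x => - lambda * (t - x)) expR); [exact: ct|exact: continuous_expR].
elim: k => [|k IH].
  by under eq_fun do rewrite big_ord0; rewrite big_ord0; exact: cvg_cst.
under eq_fun do rewrite big_ord_recr; rewrite big_ord_recr.
apply: cvgD; first exact: IH.
apply: cvgM; last exact: cvg_cst.
apply: (@continuous_comp _ _ _ (fun x => lambda * (t - x)) (fun x => x ^+ k)); first exact: ct.
exact: exprn_continuous.
Qed.

(** Convolution with the exponential law adds one summand. Only [v] in [[0, t[] contributes: the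
    density vanishes below 0, and [erlang] at arguments that are not positive. *)
Lemma exponential_convolution_erlang k t :
  (\int[nu]_v (erlang k (t - v))%:E = (erlang k.+1 t)%:E)%E.
Proof.
rewrite integral_exponential; last 2 first.
- apply/measurable_EFinP/measurableT_comp; first exact: measurable_erlang.
  exact: measurable_funB.
- by move=> v; rewrite lee_fin erlang_ge0.
have [t0|t0] := leP t 0.
  rewrite integral0_eq => [|v _]; first by rewrite /erlang ltNge t0.
  have [v0|v0] := ltP v 0; first by rewrite lt0_exponential_pdf// mule0.
  by rewrite /erlang subr_gt0 ltNge (le_trans t0 v0) mul0e.
transitivity (\int[mu]_(v in `[0%R, t[) (erlang_integrand k t v)%:E)%E.
  rewrite [RHS]integral_mkcond; apply: eq_integral => v _.
  rewrite patchE; case: ifPn => [|/negP] vt.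
    move: vt; rewrite inE /= in_itv/= => /andP[v0 vt].
    by rewrite exponential_pdfE// /erlang subr_gt0 vt -EFinM.
  have [v0|v0] := ltP v 0; first by rewrite lt0_exponential_pdf// mule0.
  rewrite /erlang subr_gt0; case: ifPn => [vt'|_]; last by rewrite mul0e.
  by case: vt; rewrite inE /= in_itv/= v0.
rewrite integral_itv_bndo_bndc; last first.
  apply: measurable_funTS; apply/measurable_EFinP.
  by apply: continuous_measurable_fun; exact: continuous_erlang_integrand.
have dF v := is_derive_erlang_primitive k t v.
have cF v : {for v, continuous (erlang_primitive k t)}.
  exact/differentiable_continuous/derivable1_diffP.
rewrite (@continuous_FTC2 _ _ (erlang_primitive k t))//; last 3 first.
- exact/continuous_subspaceT/continuous_erlang_integrand.
- split; first by [].
  + exact/cvg_at_right_filter/cF.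
  + exact/cvg_at_left_filter/cF.
- by move=> v _; rewrite derive1E; apply: derive_val; exact: dF.
(* At [v = t] every power has exponent at least one and vanishes; the remaining
   [- expR (- lambda * t)] is the term [j = 0] of [erlang k.+1 t]. *)
rewrite /erlang_primitive subrr mulr0 big1 ?mulr0; last first.
  by move=> j _; rewrite expr0n/= mul0r.
rewrite expR0 -EFinB /erlang t0 big_ord_recl/= subr0; congr EFin.
by rewrite expr0 fact0 divr1; ring.
Qed.

End ExponentialLaw.

(** * Lost sales and the time out of stock after an arrival *)

Section PastDiscrete.
Context (R : realType) (d : measure_display) (Omega : measurableType d)
  (P : probability Omega R).
Variable X : nat -> {RV P >-> R}.

(** All preimages, not only those of measurable sets: meant for functions with countably many
    values, without choosing a sigma-algebra on [T]. *)
Definition past_discrete n T (f : Omega -> T) := forall A : set T, past X n (f @^-1` A).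

Definition past_fun n (f : Omega -> R) :=
  @measurable_fun _ _ (pastType X n) R setT f.

Lemma past_discrete_le m n T (f : Omega -> T) :
  (m <= n)%N -> past_discrete m f -> past_discrete n f.
Proof. by move=> mn pf A; apply: past_le mn _ (pf A). Qed.

Lemma past_discrete_comp n T U (g : T -> U) (f : Omega -> T) :
  past_discrete n f -> past_discrete n (g \o f).
Proof. by move=> pf A; exact: (pf (g @^-1` A)). Qed.

Lemma past_discrete_cst n T (c : T) : past_discrete n (fun=> c).
Proof.
move=> A; have [Ac|Ac] := pselect (A c).
  rewrite (_ : _ @^-1` _ = setT); first exact: measurableT.
  by apply/seteqP; split.
rewrite (_ : _ @^-1` _ = set0); first exact: measurable0.
by apply/seteqP; split.
Qed.

(** The preimage splits along the countably many values of [f], enumerated by [pick]. *)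
Lemma past_discrete_op n T U V (op : T -> U -> V) (pick : nat -> T)
    (f : Omega -> T) (g : Omega -> U) :
  (forall x, exists i, pick i = x) ->
  past_discrete n f -> past_discrete n g ->
  past_discrete n (fun w => op (f w) (g w)).
Proof.
move=> pickP pf pg A.
rewrite (_ : _ @^-1` _ = \bigcup_i (f @^-1` [set pick i] `&` g @^-1` (op (pick i) @^-1` A))).
  by apply: bigcupT_measurable => i; apply: measurableI; [exact: pf|exact: pg].
apply/seteqP; split => w /=.
  by move=> Aw; have [i fi] := pickP (f w); exists i => //; split => //=; rewrite fi.
by move=> [i _ /= [->]].
Qed.

Lemma past_discrete_nat2 n U V (op : nat -> U -> V)
    (f : Omega -> nat) (g : Omega -> U) :
  past_discrete n f -> past_discrete n g ->
  past_discrete n (fun w => op (f w) (g w)).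
Proof. by apply: (@past_discrete_op n _ _ _ op id) => x; exists x. Qed.

Lemma past_discrete_bool2 n U V (op : bool -> U -> V)
    (f : Omega -> bool) (g : Omega -> U) :
  past_discrete n f -> past_discrete n g ->
  past_discrete n (fun w => op (f w) (g w)).
Proof.
apply: (@past_discrete_op n _ _ _ op (fun i => i == 0%N)).
by case; [exists 0%N|exists 1%N].
Qed.

Lemma past_discrete_sum n I (s : seq I) (f : I -> Omega -> nat) :
  (forall i, past_discrete n (f i)) ->
  past_discrete n (fun w => \sum_(i <- s) f i w)%N.
Proof.
move=> pf; elim: s => [|i s IH].
  by under eq_fun do rewrite big_nil; exact: past_discrete_cst.
by under eq_fun do rewrite big_cons; exact: past_discrete_nat2.
Qed.

Lemma past_fun_le m n f : (m <= n)%N -> past_fun m f -> past_fun n f.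
Proof.
move=> mn pf _ B mB; apply: (past_le mn); exact: pf.
Qed.

Lemma past_fun_ltr n f g :
  past_fun n f -> past_fun n g -> past_discrete n (fun w => f w < g w).
Proof.
move=> pf pg A; rewrite /past -[X in measurable X]setTI.
exact: (measurable_fun_ltr pf pg).
Qed.

Lemma past_fun_interarrival n i : (i < n)%N -> past_fun n (X i).
Proof. by move=> ni _ B mB; rewrite setTI; exact: past_interarrival. Qed.

Lemma past_fun_partial_sum n i k : (i + k <= n)%N ->
  past_fun n (fun w => \sum_(j < k) X (i + j)%N w).
Proof.
move=> ikn; apply: measurable_sum => j; apply: past_fun_interarrival.
by apply: leq_trans ikn; rewrite ltn_add2l.
Qed.

Lemma past_fun_arrival n : past_fun n.+1 (fun w => arrival_epochs X w n).
Proof. by apply: measurable_sum => j; exact: past_fun_interarrival. Qed.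

Lemma past_mem n A : past X n A -> past_discrete n (fun w => w \in A).
Proof.
move=> pA B; have -> : (fun w => w \in A) @^-1` B =
  (A `&` [set _ | B true]) `|` (~` A `&` [set _ | B false]).
  apply/seteqP; split => w /=.
    by case: (asboolP (A w)) => Aw; [rewrite mem_set//; left|rewrite memNset//; right].
  by move=> [[Aw]|[Aw]]; [rewrite mem_set|rewrite memNset].
apply: measurableU; apply: measurableI => //; last 2 first.
- exact: measurableC.
- exact: (@past_discrete_cst n bool false B).
- exact: (@past_discrete_cst n bool true B).
Qed.

Lemma past_discrete_measurable n T (f : Omega -> T) A :
  past_discrete n f -> measurable (f @^-1` A).
Proof. by move=> pf; exact: (past_measurable (pf A)). Qed.

End PastDiscrete.

Section System.
Context (R : realType) (d : measure_display) (Omega : measurableType d)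
  (P : probability Omega R) (r q : nat) (lambda tau : R)
  (X : nat -> {RV P >-> R}) (s0 : inventory R).
Hypotheses (q_gt0 : (0 < q)%N) (lambda_gt0 : 0 < lambda)
  (hX : poisson_interarrivals lambda X) (hs0 : admissible r q tau s0)
  (X_gt0 : forall n w, 0 < X n w).

Notation a w := (arrival_epochs X w).
Notation L w n := (lost r q tau s0 (a w) n).
Notation O w n := (ordered r q tau s0 (a w) n).
Notation st w n := (state_after r q tau s0 (a w) n).

Lemma arrival_epochsS w n : a w n.+1 = a w n + X n.+1 w.
Proof. by rewrite /arrival_epochs big_ord_recr. Qed.

Lemma arrival_epochsD w n k :
  a w (n + k)%N = a w n + \sum_(j < k) X (n.+1 + j)%N w.
Proof.
elim: k => [|k IH]; first by rewrite big_ord0 addn0 addr0.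
by rewrite addnS arrival_epochsS IH big_ord_recr /= addrA addSn.
Qed.

Lemma arrival_epochs_lt w : {homo a w : i j / (i < j)%N >-> i < j}.
Proof.
by apply: homo_ltn lt_trans _ => i; rewrite arrival_epochsS ltrDl.
Qed.

Lemma arrival_epochs_le w : {homo a w : i j / (i <= j)%N >-> i <= j}.
Proof.
by apply: homo_leq le_trans _ => // i; rewrite arrival_epochsS lerDl ltW.
Qed.

Lemma arrival_epochs_gt0 w n : 0 < a w n.
Proof.
apply: (@lt_le_trans _ _ (a w 0%N)); last exact: arrival_epochs_le.
by rewrite /arrival_epochs big_ord1.
Qed.

Lemma past_onhand_deliver m n (T : Omega -> R) :
  (n <= m)%N -> past_fun X m T -> (forall w i, (i < n)%N -> a w i <= T w) ->
  (forall i, (i < n)%N -> past_discrete X m (fun w => L w i)) ->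
  (forall i, (i < n)%N -> past_discrete X m (fun w => O w i)) ->
  past_discrete X m (fun w => onhand (deliver q (T w) (st w n))).
Proof.
move=> nm pT aT pL pO.
under eq_fun => w do rewrite (@onhand_deliver _ r q tau s0 (a w) (T w) n (aT w)).
have sumO : past_discrete X m (fun w => \sum_(i < n) O w i)%N.
  apply: past_discrete_sum => i; apply: (past_discrete_comp nat_of_bool).
  exact: pO.
have sumL : past_discrete X m (fun w => \sum_(i < n) ~~ L w i)%N.
  apply: past_discrete_sum => i.
  apply: (past_discrete_comp (fun b => nat_of_bool (~~ b))).
  exact: pL.
apply: (past_discrete_nat2 subn).
  apply: (past_discrete_nat2 subn); last exact: sumL.
  exact: (past_discrete_comp (fun k => (position q s0 + q * k)%N)) sumO.
apply: (past_discrete_comp (fun k => (q * k)%N)).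
apply: (past_discrete_nat2 addn).
  elim: (due s0) => [|e u IH] /=; first exact: past_discrete_cst.
  apply: (past_discrete_nat2 addn) IH.
  apply: (past_discrete_comp nat_of_bool); apply: past_fun_ltr => //.
  exact: measurable_cst.
apply: past_discrete_sum => i; apply: (past_discrete_comp nat_of_bool).
apply: (past_discrete_bool2 andb); first exact: pO.
apply: past_fun_ltr => //; apply: measurable_funD => //.
exact: (past_fun_le (leq_trans (ltn_ord i) nm) (@past_fun_arrival _ _ _ _ X i)).
Qed.

(** The flags at [n] are functions of all earlier flags and of comparisons with the epoch [a w n],
    hence the strong induction. The epoch involves [X n], hence the index [n.+1]. *)
Lemma past_lost_ordered n :
  past_discrete X n.+1 (fun w => L w n) /\ past_discrete X n.+1 (fun w => O w n).
Proof.
elim/ltn_ind: n => n IH.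
have pL i : (i < n)%N -> past_discrete X n.+1 (fun w => L w i).
  by move=> ni; apply: past_discrete_le (IH i ni).1; exact: ltnW.
have pO i : (i < n)%N -> past_discrete X n.+1 (fun w => O w i).
  by move=> ni; apply: past_discrete_le (IH i ni).2; exact: ltnW.
have pLn : past_discrete X n.+1 (fun w => L w n).
  apply: (past_discrete_comp (fun k => k == 0%N)).
  apply: past_onhand_deliver => //; first exact: past_fun_arrival.
  by move=> w i /ltnW; exact: arrival_epochs_le.
split => //; rewrite /ordered.
apply: (past_discrete_bool2 (fun b => andb (~~ b))) => //.
apply: (past_discrete_comp (fun k => k == r.+1)).
rewrite (_ : (fun w => _) = (fun w => (position q s0 + q * \sum_(i < n) O w i
    - \sum_(i < n) ~~ L w i)%N)); last first.
  by apply/funext => w; rewrite position_deliver -position_sum addnK.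
apply: (past_discrete_nat2 subn).
  apply: (past_discrete_comp (fun k => (position q s0 + q * k)%N)).
  apply: past_discrete_sum => i; apply: (past_discrete_comp nat_of_bool).
  exact: pO.
apply: past_discrete_sum => i.
apply: (past_discrete_comp (fun b => nat_of_bool (~~ b))).
exact: pL.
Qed.

Notation GR := (measurableTypeR R).
Notation law n := (distribution P (interarrival X n)).

Lemma lawE n (A : set GR) : measurable A -> law n A = exponential_prob lambda A.
Proof. by move=> mA; rewrite -(hX.2 n A mA). Qed.

(** Induction on [k] for all [t] together: the last summand [X (n + k)] is integrated out, and a
    value [v] of it turns [t] into [t - v]. *)
Lemma prob_partial_sum n k t A : past X n A ->
  P (A `&` [set w | \sum_(j < k) X (n + j)%N w < t]) = (P A * (erlang lambda k t)%:E)%E.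
Proof.
move=> pA; elim: k t => [|k IH] t.
  under eq_set do rewrite big_ord0.
  rewrite /erlang; case: ifPn => t0.
    rewrite big_ord0 mulr0 subr0 mule1; congr (P _).
    by apply/seteqP; split => w //= -[].
  by rewrite mule0 (_ : _ `&` _ = set0) ?measure0//; apply/seteqP; split => w //= -[].
pose S k w := \sum_(j < k) X (n + j)%N w.
have pS : past_fun X (n + k)%N (S k) by exact: past_fun_partial_sum.
(* The event [A] travels with the partial sum as a boolean coordinate, so that both form a single
   past variable. *)
have pY : @measurable_fun _ _ (pastType X (n + k)) (bool * R)%type setT
    (fun w => (w \in A, S k w)).
  apply: measurable_fun_pair => // _ B mB; rewrite setTI.
  by apply: past_mem; apply: past_le pA; exact: leq_addr.
pose Y w := (w \in A, S k w).
pose D := [set z : bool * R * GR | z.1.1 && (z.1.2 + z.2 < t)].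
have mD : measurable D.
  rewrite -[X in measurable X]setTI; apply: measurable_and => //.
    by apply: measurableT_comp => //; exact: measurable_fst.
  apply: measurable_fun_ltr => //; apply: measurable_funD; last first.
    exact: measurable_snd.
  by apply: measurableT_comp => //; exact: measurable_snd.
pose h (z : bool * R * GR) : \bar R := (\1_D z)%:E.
have mh : measurable_fun setT h by exact/measurable_EFinP/measurable_indic.
have hE w v : h (Y w, v) = (\1_(A `&` [set w | S k w < t - v]) w)%:E.
  rewrite /h/= !indicE; congr ((nat_of_bool _)%:R%:E).
  apply/idP/idP; rewrite !inE/=.
    by move=> /andP[]; rewrite inE ltrBrDr.
  by rewrite /D /= ltrBrDr => -[Aw ->]; rewrite mem_set.
have mS s : measurable (A `&` [set w | S k w < s]).
  apply: measurableI; first exact: past_measurable pA.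
  rewrite -[X in measurable X]setTI.
  apply: measurable_fun_ltr => //; exact: past_measurable_fun pS.
transitivity (\int[P]_w h (Y w, X (n + k)%N w))%E.
  rewrite -[X in P X]setIT -integral_indic//; last first.
    apply: measurableI; first exact: past_measurable pA.
    rewrite -[X in measurable X]setTI; apply: measurable_fun_ltr => //.
    exact: (past_measurable_fun (past_fun_partial_sum (leqnn (n + k.+1)))).
  apply: eq_integral => w _; rewrite hE !indicE; congr ((nat_of_bool _)%:R%:E).
  by apply/idP/idP; rewrite !inE/= big_ord_recr/= ltrBrDr.
rewrite (past_fubini_swap hX.1 pY mh)//; last by move=> z; rewrite lee_fin.
under eq_integral do under eq_integral do rewrite hE.
transitivity (\int[law (n + k)]_v (P A * (erlang lambda k (t - v))%:E))%E.
  apply: eq_integral => v _; rewrite -IH.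
  by rewrite integral_indic// setIT.
rewrite ge0_integralZl//; last 2 first.
- apply/measurable_EFinP; apply: measurableT_comp; first exact: measurable_erlang.
  exact: measurable_funB.
- by move=> v _; rewrite lee_fin erlang_ge0.
by rewrite (exponential_convolution_erlang lambda_gt0 (@lawE (n + k)%N)).
Qed.

Lemma measurable_lost n : measurable [set w | L w n].
Proof. exact: (past_discrete_measurable [set b | b] (past_lost_ordered n).1). Qed.

Lemma past_ordered n : past X n.+1 [set w | O w n].
Proof. exact: ((past_lost_ordered n).2 [set b | b]). Qed.

(** Seeding the fold with the head makes it the minimum of a nonempty list; 0 is the value for the
    empty list only. *)
Definition next_due (u : seq R) : R := foldr Num.min (head 0 u) u.

Lemma lt_next_due (t : R) (u : seq R) :
  u != [::] -> (t < next_due u) = all (fun e => t < e) u.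
Proof.
have E (e : R) (v : seq R) : (t < foldr Num.min e v) = (t < e) && all (fun e => t < e) v.
  by elim: v => [|f v IH] /=; rewrite ?andbT// lt_min IH andbCA.
by case: u => //= e u _; rewrite lt_min E andbA andbb.
Qed.

(* How long the system stays out of stock after arrival number n if no further
   customer arrives. *)
Definition stockout_time w n : R :=
  if onhand (st w n.+1) == 0%N then Num.max 0 (next_due (due (st w n.+1)) - a w n)
  else 0.

Lemma stockout_time_ge0 w n : 0 <= stockout_time w n.
Proof. by rewrite /stockout_time; case: ifP => // _; rewrite le_max lexx. Qed.

(** The position exceeds [r], so an empty shelf comes with an outstanding order and the default of
    [next_due] is not reached. *)
Lemma lt_stockout_time w n (u : R) : 0 <= u ->
  (u < stockout_time w n) = (onhand (deliver q (a w n + u) (st w n.+1)) == 0%N).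
Proof.
move=> u0; rewrite /stockout_time.
have := position_bounds (a w) q_gt0 hs0 n.+1.
rewrite (onhand_deliver_eq0 q_gt0).
case: (state_after r q tau s0 (a w) n.+1) => -[|l] s /=; last by rewrite ltNge u0.
rewrite /position /outstanding /= add0n => b.
have s0' : s != [::] by case: s b => //; rewrite muln0.
by rewrite lt_max ltNge u0 ltrBrDl lt_next_due.
Qed.

Lemma lost_stockout_time w n : L w n.+1 = (X n.+1 w < stockout_time w n).
Proof. by rewrite lt_stockout_time ?(ltW (X_gt0 _ _))// -arrival_epochsS. Qed.

(** Half-lines []u, +oo[] generate. For [u >= 0] the event says that, without further demand, the
    shelf is still empty [u] after arrival [n], which the flags up to [n] and the epochs decide. *)
Lemma past_stockout_time n : past_fun X n.+1 (fun w => stockout_time w n).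
Proof.
apply: (measurability (@RGenOInfty.G R)); first exact: RGenOInfty.measurableE.
move=> _ [_ [u ->] <-]; rewrite setTI.
have [u0|u0] := ltP u 0.
  rewrite (_ : _ @^-1` _ = setT); first exact: measurableT.
  apply/seteqP; split => w //= _.
  by rewrite in_itv/= andbT (lt_le_trans u0)// stockout_time_ge0.
rewrite (_ : _ @^-1` _ = (fun w => onhand (deliver q (a w n + u) (st w n.+1)))
    @^-1` [set 0%N]).
  apply: past_onhand_deliver => //.
  - by apply: measurable_funD => //; exact: past_fun_arrival.
  - move=> w i; rewrite ltnS => ni; rewrite -[a w i]addr0 lerD//.
    exact: arrival_epochs_le.
  - move=> i; rewrite ltnS => ni.
    by apply: past_discrete_le (past_lost_ordered i).1.
  - move=> i; rewrite ltnS => ni.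
    by apply: past_discrete_le (past_lost_ordered i).2.
apply/seteqP; split => w; rewrite /preimage/mkset in_itv/= andbT lt_stockout_time//.
  by move/eqP.
by move/eqP.
Qed.

Lemma mean_stockout_time n :
  (\int[P]_w (Num.min (X n.+1 w) (stockout_time w n))%:E =
   (lambda^-1)%:E * P [set w | L w n.+1])%E.
Proof.
pose h (z : R * GR) : \bar R := (Num.max 0 (Num.min z.2 z.1 : R))%:E.
have mh : measurable_fun setT h.
  apply/measurable_EFinP/measurable_maxr => //; apply: measurable_minr => //.
have h0 z : (0 <= h z)%E by rewrite lee_fin le_max lexx.
pose D := [set z : R * GR | z.2 < z.1].
have mD : measurable D.
  rewrite -[X in measurable X]setTI; exact: measurable_fun_ltr.
pose g (z : R * GR) : \bar R := (\1_D z)%:E.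
have mg : measurable_fun setT g by exact/measurable_EFinP/measurable_indic.
have g0 z : (0 <= g z)%E by rewrite lee_fin.
have pc := @past_stockout_time n.
transitivity (\int[P]_w h (stockout_time w n, X n.+1 w))%E.
  apply: eq_integral => w _; rewrite /h /= max_r// le_min stockout_time_ge0.
  by rewrite ltW ?X_gt0.
rewrite (past_fubini hX.1 pc mh h0).
under eq_integral do rewrite /h (exponential_mean_min lambda_gt0 (@lawE n.+1)).
transitivity ((lambda^-1)%:E * \int[P]_w g (stockout_time w n, X n.+1 w))%E.
  rewrite (past_fubini hX.1 pc mg g0) -ge0_integralZl//; last 3 first.
  - apply: (measurableT_comp (f := fun y => \int[law n.+1]_v g (y, v))%E).
      exact: (@measurable_fun_fubini_tonelli_F _ _ _ _ _ (law n.+1) g mg g0).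
    exact: past_measurable_fun pc.
  - by move=> w _; exact: integral_ge0.
  - by rewrite lee_fin invr_ge0 ltW.
  apply: eq_integral => w _; congr (_ * _)%E.
  transitivity (law n.+1 (`]-oo, stockout_time w n[%classic `&` setT)).
    by rewrite setIT.
  rewrite -integral_indic//.
congr (_ * _)%E; transitivity (P ([set w | L w n.+1] `&` setT)).
  rewrite -integral_indic//; last exact: measurable_lost.
  apply: eq_integral => w _; rewrite /g !indicE; congr ((nat_of_bool _)%:R%:E).
  by apply/idP/idP; rewrite !inE/= lost_stockout_time.
by rewrite setIT.
Qed.

End System.

(** * The Poisson loss function *)

Section PoissonLoss.
Variables (R : realType) (x : R).
Hypothesis x_ge0 : 0 <= x.

Let p (j : nat) : R := x ^+ j / j`!%:R * expR (- x).

(** The probability that a Poisson variable of mean [x] is at least [k], in the complementary form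
    in which [erlang] produces it. *)
Definition poisson_tail (k : nat) : R := 1 - \sum_(j < k) x ^+ j / j`!%:R * expR (- x).

Let p_ge0 j : 0 <= p j.
Proof. by rewrite /p mulr_ge0 ?expR_ge0// divr_ge0// exprn_ge0. Qed.

Let pS j : j.+1%:R * p j.+1 = x * p j.
Proof.
rewrite /p exprS factS natrM; field.
by rewrite nat1r !pnatr_eq0 -lt0n fact_gt0.
Qed.

Lemma poisson_tailS k : poisson_tail k = poisson_tail k.+1 + p k.
Proof. by rewrite /poisson_tail big_ord_recr/= -/(p k) opprD addrA subrK. Qed.

Lemma cvg_poisson_tail : poisson_tail @ \oo --> (0 : R).
Proof.
rewrite (_ : poisson_tail = fun k => 1 - series (exp_coeff x) k * expR (- x)); last first.
  by apply/funext => k; rewrite /poisson_tail -mulr_suml /series /= big_mkord.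
rewrite -[X in _ --> X](subrr 1) -[X in _ - X](expRxMexpNx_1 x).
apply: cvgB; first exact: cvg_cst.
by apply: cvgMl; exact: is_cvg_series_exp_coeff.
Qed.

Lemma poisson_tail_nonincreasing : nonincreasing_seq poisson_tail.
Proof. by apply/nonincreasing_seqP => k; rewrite [leRHS]poisson_tailS lerDl. Qed.

Lemma poisson_tail_ge0 k : 0 <= poisson_tail k.
Proof.
rewrite -(cvg_lim _ cvg_poisson_tail)//.
by apply: nonincreasing_cvgn_ge; [exact: poisson_tail_nonincreasing|exact: cvgP cvg_poisson_tail].
Qed.

Let sum_p m n : (m <= n)%N ->
  \sum_(m <= j < n) p j = poisson_tail m - poisson_tail n.
Proof.
elim: n => [|n IH]; first by rewrite leqn0 => /eqP ->; rewrite big_geq// subrr.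
rewrite leq_eqVlt => /predU1P[->|]; first by rewrite big_geq// subrr.
rewrite ltnS => mn; rewrite big_nat_recr//= IH//.
by rewrite (poisson_tailS n) opprD addrA subrK.
Qed.

(** For [j >= n], [(n + 1) p_(j+1) <= (j + 1) p_(j+1) = x p_j]. This is summed over a finite range,
    whose end [M] then goes to infinity. *)
Lemma poisson_tail_succ_le n : n.+1%:R * poisson_tail n.+1 <= x * poisson_tail n.
Proof.
have H M : (n <= M)%N -> n.+1%:R * (poisson_tail n.+1 - poisson_tail M.+1) <= x * poisson_tail n.
  move=> nM; rewrite -sum_p// (@le_trans _ _ (x * (poisson_tail n - poisson_tail M)))//; last first.
    by rewrite ler_wpM2l// lerBlDr lerDl poisson_tail_ge0.
  rewrite -sum_p// !mulr_sumr big_add1/= !big_nat; apply: ler_sum => j /andP[nj _].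
  by rewrite -pS ler_wpM2r// ler_nat ltnS.
have C : (fun M => n.+1%:R * (poisson_tail n.+1 - poisson_tail M.+1)) @ \oo -->
    n.+1%:R * (poisson_tail n.+1 - 0).
  apply: cvgMr; apply: cvgB; first exact: cvg_cst.
  by rewrite (cvg_shiftS poisson_tail); exact: cvg_poisson_tail.
rewrite -[X in _ * X <= _]subr0 -(cvg_lim _ C)//.
apply: limr_le; first exact: cvgP C.
by near=> M; apply: H; near: M; exact: nbhs_infty_ge.
Unshelve. all: end_near.
Qed.

Lemma cvg_mul_poisson_tail : (fun n => n%:R * poisson_tail n) @ \oo --> (0 : R).
Proof.
rewrite -(cvg_shiftS (fun n => n%:R * poisson_tail n)).
apply: (@squeeze_cvgr _ _ _ _ (cst 0) (fun n => x * poisson_tail n)).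
- near=> n; rewrite poisson_tail_succ_le andbT mulr_ge0//.
  exact: poisson_tail_ge0.
- exact: cvg_cst.
- by rewrite -[X in _ --> X](mulr0 x); apply: cvgMr; exact: cvg_poisson_tail.
Unshelve. all: end_near.
Qed.

Variable r : nat.

Let partial_loss n : R :=
  \sum_(r <= k < n) (k%:R - r%:R) * (x ^+ k / k`!%:R) * expR (- x).

(** Summation by parts. The boundary term tends to 0, because [n * poisson_tail n] does. *)
Let partial_lossE n : (r <= n)%N ->
  partial_loss n = \sum_(r <= k < n) poisson_tail k.+1 - (n - r)%:R * poisson_tail n.
Proof.
rewrite /partial_loss; elim: n => [|n IH].
  by rewrite leqn0 => /eqP ->; rewrite !big_geq// subnn mul0r subrr.
rewrite leq_eqVlt => /predU1P[->|]; first by rewrite !big_geq// subnn mul0r subrr.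
rewrite ltnS => rn; rewrite !big_nat_recr//= IH// -natrB// -mulrA -/(p n).
by rewrite subSn// (poisson_tailS n) -natr1; ring.
Qed.

Let partial_loss_nd : nondecreasing_seq partial_loss.
Proof.
apply/nondecreasing_seqP => n; rewrite /partial_loss.
have [rn|nr] := leqP r n; last by rewrite !big_geq// ltnW.
by rewrite big_nat_recr//= lerDl -mulrA -/(p n) mulr_ge0 ?p_ge0// subr_ge0 ler_nat.
Qed.

(** Dropping [r] leaves a partial sum of the Poisson mean. Together with monotonicity, this bound
    makes the [limn] in [LOSS] a genuine limit. *)
Let partial_loss_le n : partial_loss n <= x.
Proof.
apply: (@le_trans _ _ (\sum_(0 <= k < n) k%:R * p k)).
  have [rn|nr] := leqP r n; last first.
    rewrite /partial_loss big_geq ?(ltnW nr)//.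
    by apply: sumr_ge0 => k _; rewrite mulr_ge0.
  rewrite (big_cat_nat (n := r))//= /partial_loss ler_wpDl//.
    by apply: sumr_ge0 => k _; rewrite mulr_ge0.
  by apply: ler_sum => k _; rewrite -mulrA -/(p k) ler_wpM2r// gerBl.
case: n => [|n]; first by rewrite big_geq.
rewrite big_nat_recl// mul0r add0r.
under eq_bigr do rewrite pS.
rewrite -mulr_sumr sum_p// /poisson_tail big_ord0 subr0.
rewrite ler_piMr// lerBlDr lerDl; exact: poisson_tail_ge0.
Qed.

Let cvg_partial_loss : partial_loss @ \oo --> LOSS x r.
Proof.
apply: nondecreasing_is_cvgn => //; exists x => _ [n _ <-].
exact: partial_loss_le.
Qed.

Lemma cvg_sum_poisson_tail :
  (fun n => \sum_(r <= k < n) poisson_tail k.+1) @ \oo --> LOSS x r.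
Proof.
have H : (fun n => n%:R * poisson_tail n - r%:R * poisson_tail n) @ \oo --> (0 - r%:R * 0 : R).
  apply: cvgB; first exact: cvg_mul_poisson_tail.
  by apply: cvgMr; exact: cvg_poisson_tail.
have {}H : (fun n => partial_loss n + (n%:R * poisson_tail n - r%:R * poisson_tail n)) @ \oo
    --> LOSS x r + (0 - r%:R * 0).
  by apply: cvgD => //; exact: cvg_partial_loss.
move: H; rewrite mulr0 subr0 addr0; apply: cvg_trans; apply: near_eq_cvg; near=> n.
have rn : (r <= n)%N by near: n; exact: nbhs_infty_ge.
by rewrite partial_lossE// natrB// mulrBl subrK.
Unshelve. all: end_near.
Qed.

Lemma sum_poisson_tail_le n : \sum_(r <= k < n) poisson_tail k.+1 <= LOSS x r.
Proof.
rewrite -(cvg_lim _ cvg_sum_poisson_tail)//.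
apply: (nondecreasing_cvgn_le (u_ := fun n => \sum_(r <= k < n) poisson_tail k.+1)); last first.
  exact: cvgP cvg_sum_poisson_tail.
apply/nondecreasing_seqP => m.
have [rm|mr] := leqP r m; last by rewrite !big_geq// ltnW.
by rewrite big_nat_recr//= lerDl poisson_tail_ge0.
Qed.

Lemma LOSS_ge0 : 0 <= LOSS x r.
Proof. by apply: le_trans (sum_poisson_tail_le r); rewrite big_geq. Qed.

End PoissonLoss.

(** * Long run averages *)

Section ProbBool.
Context (R : realType) (d : measure_display) (Omega : measurableType d)
  (P : probability Omega R).

Definition pr (f : Omega -> bool) : R := fine (P [set w | f w]).

Lemma pr_ge0 (f : Omega -> bool) : 0 <= pr f.
Proof. exact: fine_ge0. Qed.

Lemma pr_le1 (f : Omega -> bool) : measurable [set w | f w] -> pr f <= 1.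
Proof. by move=> mf; rewrite -lee_fin fineK ?fin_num_measure// probability_le1. Qed.

Lemma integral_sum_bool I (s : seq I) (F : I -> Omega -> bool) :
  (forall i, measurable [set w | F i w]) ->
  (\int[P]_w (\sum_(i <- s) F i w)%N%:R%:E = (\sum_(i <- s) pr (F i))%:E)%E /\
  measurable_fun setT (fun w => (\sum_(i <- s) F i w)%N%:R : R).
Proof.
move=> mF; elim: s => [|i s [Es mss]].
  split; last by under eq_fun do rewrite big_nil; exact: measurable_cst.
  by rewrite big_nil integral0_eq// => w _; rewrite big_nil.
have mf := mF i; set f := F i in mf *.
have Ef w : (f w)%:R = \1_[set w | f w] w :> R.
  by rewrite indicE; congr (nat_of_bool _)%:R; apply/idP/idP; rewrite inE.
have mf' : measurable_fun setT (fun w => (f w)%:R : R).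
  by under eq_fun do rewrite Ef; exact: measurable_indic.
split; last first.
  by under eq_fun do rewrite big_cons natrD; exact: measurable_funD.
under eq_integral do rewrite big_cons natrD EFinD.
rewrite ge0_integralD//; last 2 first.
- exact/measurable_EFinP.
- exact/measurable_EFinP.
rewrite Es big_cons EFinD; congr (_ + _)%E.
by under eq_integral do rewrite Ef; rewrite integral_indic// setIT fineK// fin_num_measure.
Qed.

(** The common shape of the pathwise inequalities between counts, with an additive constant for the
    boundary effects; integration turns counts into sums of probabilities. *)
Lemma pr_sum_le I J (s : seq I) (t : seq J) (F : I -> Omega -> bool)
    (G : J -> Omega -> bool) (k c m : nat) :
  (forall i, measurable [set w | F i w]) ->
  (forall j, measurable [set w | G j w]) ->
  (forall w, k * \sum_(i <- s) F i w <= c + m * \sum_(j <- t) G j w)%N ->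
  k%:R * \sum_(i <- s) pr (F i) <= c%:R + m%:R * \sum_(j <- t) pr (G j).
Proof.
move=> mF mG st.
have [Es mss] := integral_sum_bool s mF; have [Et mst] := integral_sum_bool t mG.
rewrite -lee_fin EFinD !EFinM -Es -Et.
rewrite -!ge0_integralZl//; try exact/measurable_EFinP; try by move=> w _; rewrite lee_fin.
have -> : c%:R%:E = (\int[P]_w c%:R%:E)%E.
  rewrite integral_cst// -[LHS]mule1; congr (_ * _)%E.
  exact/esym/probability_setT.
have g0 w : setT w -> (0 <= m%:R%:E * (\sum_(j <- t) G j w)%N%:R%:E :> \bar R)%E.
  by move=> _; rewrite -EFinM lee_fin mulr_ge0.
have mg : measurable_fun setT (fun w => m%:R%:E * (\sum_(j <- t) G j w)%N%:R%:E : \bar R)%E.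
  by apply/measurable_EFinP; exact: measurable_funM.
rewrite -ge0_integralD//.
apply: ge0_le_integral => //.
- by apply/measurable_EFinP; exact: measurable_funM.
- exact: emeasurable_funD.
- by move=> w _; rewrite -!EFinM -EFinD lee_fin -!natrM -natrD ler_nat.
Qed.

End ProbBool.

(** * Moments and divergence of the arrival epochs *)

Section Arrivals.
Context (R : realType) (d : measure_display) (Omega : measurableType d)
  (P : probability Omega R) (lambda : R) (X : nat -> {RV P >-> R}).
Hypotheses (lambda_gt0 : 0 < lambda) (hX : poisson_interarrivals lambda X)
  (X_gt0 : forall n w, 0 < X n w).

Notation GR := (measurableTypeR R).
Notation law n := (distribution P (interarrival X n)).
Let A n w := \sum_(j < n) X j w.

Let A_ge0 n w : 0 <= A n w.
Proof. by apply: sumr_ge0 => j _; exact: ltW. Qed.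

Let AS n w : A n.+1 w = A n w + X n w.
Proof. by rewrite /A big_ord_recr. Qed.

Let pastA n : past_fun X n (A n).
Proof. by apply: measurable_sum => j; exact: past_fun_interarrival. Qed.

Let mA n : measurable_fun setT (A n).
Proof. exact: past_measurable_fun (@pastA n). Qed.

Let mmax : measurable_fun setT (fun v : GR => Num.max 0 v : R).
Proof. exact: measurable_maxr. Qed.

Let meanX n : (\int[P]_w (X n w)%:E = (lambda^-1)%:E)%E.
Proof.
rewrite -(exponential_mean lambda_gt0 (@lawE R d Omega P lambda X hX n)).
rewrite (ge0_integral_distribution (interarrival X n) (f := fun v => (Num.max 0 v)%:E)).
- by apply: eq_integral => w _ /=; rewrite max_r// ltW.
- exact/measurable_EFinP.
- by move=> v; rewrite lee_fin le_max lexx.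
Qed.

Let moment2X n : (\int[P]_w (X n w ^+ 2)%:E <= (4 / lambda ^+ 2)%:E)%E.
Proof.
apply: le_trans (exponential_moment2 lambda_gt0 (@lawE R d Omega P lambda X hX n)).
rewrite (ge0_integral_distribution (interarrival X n) (f := fun v => (Num.max 0 v ^+ 2)%:E)).
- rewrite le_eqVlt; apply/orP; left; apply/eqP.
  by apply: eq_integral => w _ /=; rewrite max_r// ltW.
- exact/measurable_EFinP/measurable_funX.
- by move=> v; rewrite lee_fin sqr_ge0.
Qed.

Let meanA n : (\int[P]_w (A n w)%:E = (n%:R / lambda)%:E)%E.
Proof.
elim: n => [|n IH].
  by rewrite mul0r integral0_eq// => w _; rewrite /A big_ord0.
under eq_integral do rewrite AS EFinD.
rewrite ge0_integralD//; last 4 first.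
- by move=> w _; rewrite lee_fin.
- exact/measurable_EFinP.
- by move=> w _; rewrite lee_fin ltW.
- exact/measurable_EFinP.
by rewrite IH meanX -EFinD -[n.+1%:R]natr1 mulrDl mul1r.
Qed.

Let meanAX n : (\int[P]_w (A n w * X n w)%:E = (n%:R / lambda ^+ 2)%:E)%E.
Proof.
pose h (z : R * GR) : \bar R := (Num.max 0 z.1 * Num.max 0 (z.2 : R))%:E.
have mh : measurable_fun setT h.
  by apply/measurable_EFinP/measurable_funM; exact: measurable_maxr.
have h0 z : (0 <= h z)%E by rewrite lee_fin mulr_ge0// le_max lexx.
transitivity (\int[P]_w h (A n w, X n w))%E.
  by apply: eq_integral => w _; rewrite /h/= !max_r// ltW.
rewrite (past_fubini hX.1 (@pastA n) mh h0) /h.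
have E w : (\int[law n]_v h (A n w, v) = (A n w)%:E * (lambda^-1)%:E)%E.
  rewrite /h; under eq_integral do rewrite /= max_r// EFinM.
  rewrite ge0_integralZl//; last 3 first.
  - exact/measurable_EFinP.
  - by move=> v _; rewrite lee_fin le_max lexx.
  - by rewrite lee_fin.
  by rewrite (exponential_mean lambda_gt0 (@lawE R d Omega P lambda X hX n)).
under eq_integral do rewrite E.
rewrite ge0_integralZr//; last 3 first.
- exact/measurable_EFinP.
- by move=> w _; rewrite lee_fin.
- by rewrite lee_fin invr_ge0 ltW.
by rewrite meanA -EFinM expr2 invfM mulrA.
Qed.

(** The induction loses a multiple of [n], but the leading [n ^+ 2] is exact; it is what cancels
    against the squared mean. *)
Let moment2A n :
  (\int[P]_w (A n w ^+ 2)%:E <= ((n%:R ^+ 2 + 4 * n%:R) / lambda ^+ 2)%:E)%E.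
Proof.
elim: n => [|n IH].
  rewrite integral0_eq; last by move=> w _; rewrite /A big_ord0 expr0n.
  by rewrite lee_fin expr0n/= mulr0 addr0 mul0r.
have E w : (A n.+1 w ^+ 2)%:E = ((A n w ^+ 2)%:E + (2%:E * (A n w * X n w)%:E + (X n w ^+ 2)%:E))%E.
  rewrite -EFinM -!EFinD; congr EFin.
  by rewrite AS; ring.
under eq_integral do rewrite E.
have mAX : measurable_fun setT (fun w => (A n w * X n w)%:E).
  by apply/measurable_EFinP; exact: measurable_funM.
have mX2 : measurable_fun setT (fun w => (X n w ^+ 2)%:E).
  by apply/measurable_EFinP; exact: measurable_funX.
have mA2 : measurable_fun setT (fun w => (A n w ^+ 2)%:E).
  by apply/measurable_EFinP; exact: measurable_funX.
have AX0 w : (0 <= (A n w * X n w)%:E)%E by rewrite lee_fin mulr_ge0// ltW.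
have m2AX : measurable_fun setT (fun w => 2%:E * (A n w * X n w)%:E)%E.
  by apply: emeasurable_funM.
rewrite ge0_integralD//; last 3 first.
- by move=> w _; rewrite lee_fin sqr_ge0.
- move=> w _; apply: adde_ge0; last by rewrite lee_fin sqr_ge0.
  by apply: mule_ge0 => //; rewrite lee_fin.
- exact: emeasurable_funD.
rewrite ge0_integralD//; last 2 first.
- by move=> w _; rewrite mule_ge0// lee_fin.
- by move=> w _; rewrite lee_fin sqr_ge0.
rewrite ge0_integralZl//.
rewrite meanAX; apply: le_trans (leeD IH (leeD (lexx _) (moment2X n))) _.
rewrite -EFinM -!EFinD lee_fin -natr1.
rewrite [leLHS](_ : _ = (n%:R ^+ 2 + 6 * n%:R + 4) / lambda ^+ 2); last first.
  by field; rewrite gt_eqF.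
by rewrite ler_wpM2r ?invr_ge0 ?sqr_ge0//; lra.
Qed.

(* |y| <= eps/2 + y^2/(2 eps), applied to y = (A_n - n/lambda)/n. *)
Lemma arrival_lln (eps : R) : 0 < eps -> \forall n \near \oo,
  (\int[P]_w `|\sum_(j < n) X j w - n%:R / lambda|%:E <= (eps * n%:R)%:E)%E.
Proof.
move=> eps0; near=> n.
have n0 : 0 < n%:R :> R by rewrite ltr0n; near: n; exact: nbhs_infty_gt.
pose m : R := n%:R / lambda.
have m0 : 0 <= m by rewrite divr_ge0// ltW.
have k0 : 0 <= m / (eps * n%:R) by rewrite divr_ge0// mulr_ge0// ltW.
have k1 : 0 <= (2 * (eps * n%:R))^-1 by rewrite invr_ge0 !mulr_ge0// ltW.
have mD : measurable_fun setT (fun w => `|A n w - m|).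
  by apply: measurableT_comp => //; exact: measurable_funB.
have RHS : (\int[P]_w ((eps * n%:R / 2 + m ^+ 2 / (2 * (eps * n%:R)))%:E +
      (2 * (eps * n%:R))^-1%:E * (A n w ^+ 2)%:E) <=
    (eps * n%:R / 2 + m ^+ 2 / (2 * (eps * n%:R)) +
     (2 * (eps * n%:R))^-1 * ((n%:R ^+ 2 + 4 * n%:R) / lambda ^+ 2))%:E)%E.
  have c0 : 0 <= eps * n%:R / 2 + m ^+ 2 / (2 * (eps * n%:R)).
    by rewrite addr_ge0 ?divr_ge0 ?sqr_ge0 ?mulr_ge0// ltW.
  rewrite ge0_integralD//; last 2 first.
  - by move=> w _; rewrite -EFinM lee_fin mulr_ge0// sqr_ge0.
  - apply/measurable_EFinP; apply: measurable_funM => //; exact: measurable_funX.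
  rewrite integral_cst// [X in (_ * X)%E](_ : _ = 1%E); last exact: probability_setT.
  rewrite mule1 [leRHS]EFinD leeD2l// ge0_integralZl//; last 2 first.
  - by apply/measurable_EFinP; exact: measurable_funX.
  - by move=> w _; rewrite lee_fin sqr_ge0.
  by rewrite EFinM lee_wpmul2l// moment2A.
(* The cross term of [(A n w - m) ^+ 2] is moved to the left, so that both integrands are
   nonnegative and no integrability has to be shown. *)
have : (\int[P]_w (`|A n w - m|%:E + (m / (eps * n%:R))%:E * (A n w)%:E) <=
    \int[P]_w ((eps * n%:R / 2 + m ^+ 2 / (2 * (eps * n%:R)))%:E +
      (2 * (eps * n%:R))^-1%:E * (A n w ^+ 2)%:E))%E.
  apply: ge0_le_integral => //.
  - by move=> w _; rewrite -EFinM -EFinD lee_fin addr_ge0// mulr_ge0.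
  - by apply/measurable_EFinP/measurable_funD => //; exact: measurable_funM.
  - apply/measurable_EFinP/measurable_funD => //; apply: measurable_funM => //.
    exact: measurable_funX.
  - move=> w _; rewrite -!EFinM -!EFinD lee_fin.
    have e0 : 0 < eps * n%:R by rewrite mulr_gt0.
    move: (eps * n%:R) e0 => e e0.
    have H : 2 * e * `|A n w - m| <= e ^+ 2 + (A n w - m) ^+ 2.
      rewrite -[(A n w - m) ^+ 2]real_normK ?num_real// -subr_ge0.
      by rewrite [leRHS](_ : _ = (e - `|A n w - m|) ^+ 2) ?sqr_ge0//; ring.
    rewrite -(ler_pM2l (x := 2 * e)) ?mulr_gt0//.
    rewrite [leRHS](_ : _ = e ^+ 2 + (A n w - m) ^+ 2 + 2 * m * A n w); last first.
      by field; rewrite gt_eqF.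
    rewrite mulrDr [X in _ + X](_ : _ = 2 * m * A n w) ?lerD2r//.
    by field; rewrite gt_eqF.
rewrite ge0_integralD//; last 3 first.
- exact/measurable_EFinP.
- by move=> w _; rewrite -EFinM lee_fin mulr_ge0.
- by apply/measurable_EFinP; exact: measurable_funM.
rewrite ge0_integralZl//; last 2 first.
- exact/measurable_EFinP.
- by move=> w _; rewrite lee_fin.
rewrite meanA => /le_trans/(_ RHS); rewrite -EFinM -leeBrDr// => /le_trans; apply.
rewrite -EFinB lee_fin /m.
(* The terms with [m ^+ 2] cancel and leave a constant, which is below [eps * n%:R / 2] for large
   [n]. *)
rewrite [leLHS](_ : _ = eps * n%:R / 2 + 2 / (eps * lambda ^+ 2)); last first.
  by field; rewrite !gt_eqF.
suff : 2 / (eps * lambda ^+ 2) <= eps * n%:R / 2 by lra.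
rewrite mulrAC -ler_pdivrMl ?divr_gt0//.
by near: n; exact: nbhs_infty_ger.
Unshelve. all: end_near.
Qed.

(** All epochs stay below [M] with probability at most a Poisson tail at [n.+1], for every [n],
    hence with probability 0. Outside the union of these null events the increasing epochs are
    unbounded. *)
Lemma arrival_epochs_cvgy : {ae P, forall w, arrival_epochs X w n @[n --> \oo] --> +oo}.
Proof.
pose N M := [set w | forall n, A n.+1 w < M%:R].
have mN M : measurable (N M).
  rewrite (_ : N M = \bigcap_n [set w | A n.+1 w < M%:R]); last first.
    by apply/seteqP; split => w /= H n; [move=> _|]; exact: H.
  apply: bigcapT_measurable => n; rewrite -[X in measurable X]setTI.
  exact: measurable_fun_ltr.
have N0 M : P (N M) = 0%E.
  apply/eqP; rewrite eq_le measure_ge0 andbT.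
  have [->|M0] := eqVneq M 0%N.
    rewrite (_ : N 0%N = set0) ?measure0//; apply/seteqP; split => w //= /(_ 0%N).
    by rewrite ltNge A_ge0.
  have M0' : 0 < M%:R :> R by rewrite ltr0n lt0n.
  have H n : (P (N M) <= (poisson_tail (lambda * M%:R) n.+1)%:E)%E.
    have past0T : past X 0 setT by exact: measurableT.
    have := prob_partial_sum lambda_gt0 hX n.+1 M%:R past0T.
    rewrite setTI [P setT]probability_setT mul1e /erlang M0' => E.
    apply: (@le_trans _ _ (P [set w | \sum_(j < n.+1) X (0 + j)%N w < M%:R])).
      apply: le_measure; rewrite ?inE//.
      - rewrite -[X in measurable X]setTI; apply: measurable_fun_ltr => //.
        exact: mA.
      - by move=> w /(_ n).
    by rewrite E /poisson_tail lee_fin mulr_sumr mulNr; under eq_bigr do rewrite mulrC.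
  have C := @cvg_poisson_tail R (lambda * M%:R).
  rewrite -[P _]fineK ?fin_num_measure// lee_fin.
  rewrite -(cvg_lim _ C)//; apply: limr_ge; first exact: cvgP C.
  near=> n; have n0 : (0 < n)%N by near: n; exact: nbhs_infty_gt.
  by rewrite -lee_fin fineK ?fin_num_measure// -(prednK n0).
suff : P.-negligible (\bigcup_M N M).
  apply: negligibleS => w /= aw; apply: contrapT => NM; apply: aw.
  apply/cvgryPge => y.
  have [n An] : exists n, (Num.truncn y).+1%:R <= A n.+1 w.
    apply: contrapT => H; apply: NM; exists (Num.truncn y).+1 => // n.
    by rewrite ltNge; apply/negP => An; apply: H; exists n.
  near=> k; apply: (@le_trans _ _ (A n.+1 w)).
    by apply: le_trans An; apply/ltW/truncnS_gt.
  rewrite -[A n.+1 w]/(arrival_epochs X w n).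
  by apply: arrival_epochs_le => //; near: k; exact: nbhs_infty_ge.
apply: negligible_bigcup => M; exists (N M); split => //.
exact: N0.
Unshelve. all: end_near.
Qed.

End Arrivals.

(** * Time out of stock along one sample path *)

Section StockoutSet.
Context (R : realType) (d : measure_display) (Omega : measurableType d)
  (P : probability Omega R) (r q : nat) (tau : R)
  (X : nat -> {RV P >-> R}) (s0 : inventory R).
Hypotheses (q_gt0 : (0 < q)%N) (hs0 : admissible r q tau s0)
  (X_gt0 : forall n w, 0 < X n w).

Notation a w := (arrival_epochs X w).
Notation st w n := (state_after r q tau s0 (a w) n).
Notation GR := (measurableTypeR R).
Notation mu := (@lebesgue_measure R).
Variable w : Omega.

Let c n := stockout_time r q tau X s0 w n.

Definition stockout_set : set GR :=
  [set u | onhand (state_at r q tau s0 (a w) u) = 0%N].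

Lemma arrivals_upto_lt0 (u : R) : u < a w 0 -> arrivals_upto (a w) u = 0%N.
Proof.
move=> ua; rewrite /arrivals_upto (_ : [set n | _] = set0) ?fset_set0//.
apply/seteqP; split => n //= /le_lt_trans/(_ ua).
by rewrite ltNge arrival_epochs_le.
Qed.

Lemma arrivals_upto_itv n (u : R) :
  a w n <= u -> u < a w n.+1 -> arrivals_upto (a w) u = n.+1.
Proof.
move=> nu un; rewrite /arrivals_upto (_ : [set m | _] = `I_n.+1).
  by apply: card_fset_set; exact: card_eqxx.
apply/seteqP; split => m /=.
  move=> mu'; rewrite ltnNge; apply/negP => nm.
  have := arrival_epochs_le X_gt0 w nm.
  by rewrite leNgt (le_lt_trans mu' un).
by rewrite ltnS => mn; apply: le_trans nu; exact: arrival_epochs_le.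
Qed.

Lemma measurable_deliver_empty (s : inventory R) :
  measurable ([set u | onhand (deliver q u s) = 0%N] : set GR).
Proof.
have -> : ([set u | onhand (deliver q u s) = 0%N] : set GR) =
    [set u | (onhand s == 0%N) && all (fun e => u < e) (due s)].
  by apply/seteqP; split => u; rewrite /mkset -(onhand_deliver_eq0 q_gt0) => /eqP.
case: (onhand s == 0%N) => /=; last first.
  by rewrite (_ : [set u | _] = set0)//; apply/seteqP; split.
elim: (due s) => [|e v IH] /=.
  by rewrite (_ : [set u | _] = setT)//; apply/seteqP; split.
rewrite (_ : [set u | _] = [set u | u < e] `&` [set u : GR | all (fun e => u < e) v]).
  apply: measurableI => //; rewrite -[X in measurable X]setTI.
  exact: measurable_fun_ltr.
by apply/seteqP; split => u /= => [/andP[]|[-> ->]].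
Qed.

(** Between two arrivals the stock changes only by deliveries, which raise it, so the time out of
    stock is an initial segment. *)
Lemma stockout_set_piece n :
  stockout_set `&` `[a w n, a w n.+1[ = `[a w n, a w n + Num.min (X n.+1 w) (c n)[%classic.
Proof.
apply/seteqP; split => u /=; rewrite !in_itv/=.
  move=> [su /andP[nu un]]; rewrite nu /= -ltrBlDl lt_min ltrBlDl -arrival_epochsS un /=.
  rewrite lt_stockout_time ?subr_ge0// subrKC; apply/eqP.
  by rewrite -su /stockout_set /mkset /state_at (arrivals_upto_itv nu un).
rewrite -ltrBlDl lt_min ltrBlDl -arrival_epochsS => /and3P[nu un uc].
split; last by rewrite nu.
rewrite /stockout_set /mkset /state_at (arrivals_upto_itv nu un); apply/eqP.
by move: uc; rewrite lt_stockout_time ?subr_ge0// subrKC.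
Qed.

Lemma stockout_set_initial :
  stockout_set `&` `[0, a w 0[ = [set u | onhand (deliver q u s0) = 0%N] `&` `[0, a w 0[%classic.
Proof.
apply/seteqP; split => u /= [su u0]; (split; last by []); move: u0;
  rewrite in_itv/= => /andP[_ u0]; move: su;
  by rewrite /stockout_set /mkset /state_at (arrivals_upto_lt0 u0).
Qed.

Let min_ge0 n : 0 <= Num.min (X n.+1 w) (c n).
Proof. by rewrite le_min (ltW (X_gt0 _ _)) stockout_time_ge0. Qed.

Lemma measure_stockout_set n :
  measurable (stockout_set `&` `[0, a w n[) /\
  (mu (stockout_set `&` `[0%R, a w n[) = mu (stockout_set `&` `[0%R, a w 0[) +
   (\sum_(i < n) Num.min (X i.+1 w) (c i))%:E)%E.
Proof.
elim: n => [|n [mS muS]].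
  rewrite big_ord0 adde0; split => //; rewrite stockout_set_initial.
  by apply: measurableI => //; exact: measurable_deliver_empty.
have -> : stockout_set `&` `[0, a w n.+1[ = (stockout_set `&` `[0, a w n[) `|`
    `[a w n, a w n + Num.min (X n.+1 w) (c n)[%classic.
  rewrite -stockout_set_piece -setIUr; congr (_ `&` _).
  rewrite -itv_bndbnd_setU// bnd_simp; first exact/ltW/arrival_epochs_gt0.
  exact/ltW/arrival_epochs_lt.
split; first exact: measurableU.
transitivity (mu (stockout_set `&` `[0%R, a w n[) +
    mu `[a w n, (a w n + Num.min (X n.+1 w) (c n))%R[%classic)%E.
  apply: measureU => //; apply/seteqP; split => u //=; rewrite !in_itv/= => -[[_ /andP[_ un]]] /andP[].
  by rewrite leNgt un.
rewrite muS -addeA; congr (_ + _)%E.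
rewrite big_ord_recr [RHS]EFinD; congr (_ + _)%E; rewrite lebesgue_measure_itv/=.
rewrite lte_fin ltrDl; case: ltP => [_|m0]; first by rewrite -EFinB addrC addKr.
by congr EFin; apply/eqP; rewrite eq_le min_ge0 m0.
Qed.

(** The difference is the time out of stock before the first arrival. *)
Lemma stockout_fraction_arrival n :
  0 <= a w n * stockout_fraction r q tau s0 (a w) (a w n)
       - \sum_(i < n) Num.min (X i.+1 w) (c i) <= a w 0.
Proof.
have [mS muS] := measure_stockout_set n.
have [mS0 _] := measure_stockout_set 0.
have mu0 : (mu (stockout_set `&` `[0%R, a w 0[) <= (a w 0)%:E)%E.
  apply: (@le_trans _ _ (mu `[0%R, a w 0[%classic)).
    by apply: le_measure; rewrite ?inE//; exact: subIsetr.
  by rewrite lebesgue_measure_itv/= lte_fin arrival_epochs_gt0// -EFinB subr0.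
have fin0 : mu (stockout_set `&` `[0%R, a w 0[) \is a fin_num.
  by rewrite ge0_fin_numE// (le_lt_trans mu0)// ltry.
rewrite /stockout_fraction mulrA mulfV ?mul1r; last by rewrite gt_eqF// arrival_epochs_gt0.
(* Measurability has been shown for truncations of [stockout_set], so its indicator is replaced by
   that of a truncation. *)
have ind u : `[0, a w n[%classic u ->
    \1_(stockout_set `&` `[0, a w n[) u = \1_stockout_set u :> R.
  by move=> un; rewrite !indicE in_setI (mem_set un) andbT.
rewrite /Rintegral -integral_itv_bndo_bndc; last first.
  have mSn : measurable_fun `[0, a w n[%classic
      (\1_(stockout_set `&` `[0, a w n[) : GR -> R).
    exact/measurable_funTS/measurable_indic.
  apply/measurable_EFinP; apply: eq_measurable_fun mSn => u.
  by rewrite inE => /ind.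
rewrite (eq_integral (fun u => (\1_(stockout_set `&` `[0, a w n[) u)%:E)); last first.
  by move=> u; rewrite inE => /ind ->.
have -> : (\int[mu]_(u in `[0%R, a w n[) (\1_(stockout_set `&` `[0%R, a w n[) u)%:E =
    mu (stockout_set `&` `[0%R, a w n[))%E.
  by rewrite integral_indic// -setIA setIid.
rewrite muS fineD// addrK.
by rewrite fine_ge0//= -lee_fin fineK.
Qed.

End StockoutSet.

(** * The loss rate equals the stockout fraction *)

Section LostRate.
Context (R : realType) (d : measure_display) (Omega : measurableType d)
  (P : probability Omega R) (r q : nat) (lambda tau : R)
  (X : nat -> {RV P >-> R}) (s0 : inventory R) (gamma : R).
Hypotheses (q_gt0 : (0 < q)%N) (lambda_gt0 : 0 < lambda)
  (hX : poisson_interarrivals lambda X) (hs0 : admissible r q tau s0)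
  (X_gt0 : forall n w, 0 < X n w)
  (hgamma : long_run_stockout_fraction r q tau s0 X gamma).

Notation a w := (arrival_epochs X w).
Notation prL n := (pr P (fun w => lost r q tau s0 (a w) n)).

Let c w n := stockout_time r q tau X s0 w n.
Let Z n w := \sum_(i < n) Num.min (X i.+1 w) (c w i).

Let min_ge0 w n : 0 <= Num.min (X n.+1 w) (c w n).
Proof. by rewrite le_min (ltW (X_gt0 _ _)) stockout_time_ge0. Qed.

Let Z_ge0 n w : 0 <= Z n w.
Proof. exact: sumr_ge0. Qed.

Let a_gt0 n w : 0 < a w n.
Proof. exact: arrival_epochs_gt0. Qed.

Let Z_le n w : Z n w <= a w n.
Proof.
rewrite /arrival_epochs big_ord_recl/= -[leLHS]add0r lerD ?(ltW (X_gt0 _ _))//.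
by apply: ler_sum => i _; rewrite ge_min lexx.
Qed.

Let mX n : measurable_fun setT (X n : Omega -> R).
Proof. exact: measurable_funPT. Qed.

Let mmin n : measurable_fun setT (fun w => Num.min (X n.+1 w) (c w n)).
Proof.
apply: measurable_minr => //.
have := @past_stockout_time _ _ _ _ r q tau X s0 q_gt0 hs0 X_gt0 n.
exact: past_measurable_fun.
Qed.

Let mZ n : measurable_fun setT (Z n).
Proof. by apply: measurable_sum => i; exact: mmin. Qed.

Let ma n : measurable_fun setT (fun w => a w n).
Proof. exact: measurable_sum. Qed.

Let meanZ n : (\int[P]_w (Z n w)%:E = (lambda^-1 * \sum_(i < n) prL i.+1)%:E)%E.
Proof.
elim: n => [|n IH].
  by rewrite big_ord0 mulr0 integral0_eq// => w _; rewrite /Z big_ord0.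
under eq_integral do rewrite /Z big_ord_recr/= EFinD.
rewrite ge0_integralD//; last 4 first.
- by move=> w _; rewrite lee_fin Z_ge0.
- by apply/measurable_EFinP; exact: mZ.
- by move=> w _; rewrite lee_fin.
- by apply/measurable_EFinP; exact: mmin.
rewrite IH (mean_stockout_time q_gt0 lambda_gt0 hX hs0 X_gt0) big_ord_recr/= mulrDr EFinD; congr (_ + _)%E.
by rewrite EFinM /pr fineK// fin_num_measure//; exact: measurable_lost.
Qed.

(** The limit in real time is read along the epochs, which tend to infinity; the time before the
    first arrival costs at most [a w 0 / a w n]. *)
Let cvgZ : {ae P, forall w, Z n w / a w n @[n --> \oo] --> gamma}.
Proof.
have ay := arrival_epochs_cvgy lambda_gt0 hX X_gt0.
move: ay hgamma; apply: filterS2 => w ay hg.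
pose f n := stockout_fraction r q tau s0 (a w) (a w n).
have cf : f n @[n --> \oo] --> gamma by exact: cvg_comp ay hg.
have ca : a w 0%N / a w n @[n --> \oo] --> (0 : R).
  rewrite -[X in _ --> X](mulr0 (a w 0%N)); apply: cvgMr.
  by apply/gtr0_cvgV0 => //; near=> n.
apply: (@squeeze_cvgr _ _ _ _ (fun n => f n - a w 0%N / a w n) f) => //; last first.
  by rewrite -[X in _ --> X]subr0; exact: cvgB.
near=> n; have /andP[h0 h1] := stockout_fraction_arrival q_gt0 hs0 X_gt0 w n.
rewrite lerBlDr -mulrDl ler_pdivlMr// ler_pdivrMr// mulrC -/(f n).
by move: h0 h1; rewrite -/(f n) -/(Z n w) => h0 h1; apply/andP; split; lra.
Unshelve. all: end_near.
Qed.

Let gamma_ge0 : 0 <= gamma.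
Proof.
have [w cw] : exists w, Z n w / a w n @[n --> \oo] --> gamma.
  apply: contrapT => H; have [A [mA A0 sA]] := cvgZ.
  have : P setT = 0%E.
    apply/eqP; rewrite -measure_le0 -A0; apply: le_measure; rewrite ?inE// => w _.
    by apply: sA => /= cw; apply: H; exists w.
  by rewrite probability_setT => /eqP; rewrite onee_eq0.
rewrite -(cvg_lim _ cw)//; apply: limr_ge; first exact: cvgP cw.
by near=> n; rewrite divr_ge0// ltW.
Unshelve. all: end_near.
Qed.

Let D n w : R := `|Z n w / a w n - gamma|.

Let mD n : measurable_fun setT (D n).
Proof.
apply: measurableT_comp => //; apply: measurable_funB => //.
under eq_fun do rewrite -powR_inv1 ?(ltW (a_gt0 _ _))//.
apply: measurable_funM; first exact: mZ.
exact: measurableT_comp (measurable_powR (-1)) (@ma n).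
Qed.

(** Dominated convergence applies because the ratio of [Z n] to the epoch lies in [[0, 1]]. *)
Let cvgD0 : (\int[P]_w (D n w)%:E)%E @[n --> \oo] --> 0%E.
Proof.
have mf n : measurable_fun setT (fun w => (D n w)%:E).
  by apply/measurable_EFinP; exact: mD.
have [||_ _] := @dominated_convergence _ Omega R P setT measurableT
  (fun n w => (D n w)%:E) (fun=> 0%E) (fun=> (1 + `|gamma|)%:E)
  mf (measurable_cst _) _
  (finite_measure_integrable_cst _ _ measurableT) _; last by rewrite integral0.
- move: cvgZ; apply: filterS => w cw _.
  apply: cvg_EFin; first by near=> n.
  rewrite -[X in _ --> X](normr0 R) -(subrr gamma).
  by apply: cvg_norm; apply: cvgB => //; exact: cvg_cst.
- apply: aeW => w n _; rewrite gee0_abs ?lee_fin /D//.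
  apply: le_trans (ler_normB _ _) _; rewrite lerD2r ger0_norm ?divr_ge0 ?(ltW (a_gt0 _ _))//.
  by rewrite ler_pdivrMr ?mul1r.
Unshelve. all: end_near.
Qed.

Lemma cvg_lost_rate : ((\sum_(i < n) prL i.+1) / n%:R) @[n --> \oo] --> gamma.
Proof.
have l0 : 0 < lambda^-1 by rewrite invr_gt0.
apply/cvgrPdist_le => e e0.
(* An error [e * n] in the number of losses is [4 * e' * n] in time out of stock; the error terms
   below stay within it once [n] absorbs the constants. *)
pose e' := e * lambda^-1 / 4.
have e'0 : 0 < e' by rewrite divr_gt0// mulr_gt0.
have LLN := arrival_lln lambda_gt0 hX X_gt0 (divr_gt0 e'0 (ltr0n R 2)).
have D0 : \forall n \near \oo, (\int[P]_w (D n w)%:E <= (e / 4)%:E)%E.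
  have := cvgD0; move/fine_cvgP => [Dfin /cvgrPdist_le/(_ (e / 4))].
  move=> /(_ (divr_gt0 e0 (ltr0n R 4))) D1.
  near=> n; rewrite -[leLHS]fineK; last by near: n.
  rewrite lee_fin -[leLHS]ger0_norm; last first.
    by apply: fine_ge0; apply: integral_ge0 => w _; rewrite lee_fin normr_ge0.
  rewrite -normrN -[X in `|X|]add0r.
  by near: n.
have LLN1 : \forall n \near \oo,
    (\int[P]_w `|(\sum_(j < n.+1) X j w - n.+1%:R / lambda)%R|%:E <= (e' / 2 * n.+1%:R)%:E)%E.
  by have [N _ HN] := LLN; exists N => // n /= Nn; exact: HN (leqW Nn).
near=> n.
have n0 : 0 < n%:R :> R by rewrite ltr0n; near: n; exact: nbhs_infty_gt.
have nl0 : 0 <= n%:R / lambda by rewrite ltW// divr_gt0.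
have D_ge0 w : 0 <= D n w by exact: normr_ge0.
pose E w : R := `|\sum_(j < n.+1) X j w - n.+1%:R / lambda| + lambda^-1 + n%:R / lambda * D n w.
have E0 w : 0 <= E w.
  by apply: addr_ge0; [apply: addr_ge0; [exact: normr_ge0|exact: ltW]|exact: mulr_ge0].
have mE : measurable_fun setT E.
  apply: measurable_funD; last exact: measurable_funM.
  apply: measurable_funD => //; apply: measurableT_comp => //.
  by apply: measurable_funB => //; exact: (ma n).
have ZE w : `|Z n w - gamma * (n%:R / lambda)| <= E w.
  (* The ratio is at most 1, so the first product is controlled by the law of large numbers for the
     [n.+1] interarrival times in [a w n], with [lambda^-1] correcting the index; the second is
     controlled by dominated convergence. *)
  have -> : Z n w - gamma * (n%:R / lambda) =
     (Z n w / a w n) * (a w n - n.+1%:R / lambda + lambda^-1) + n%:R / lambda * (Z n w / a w n - gamma).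
    rewrite -[n.+1%:R]natr1; field.
    by rewrite !gt_eqF.
  apply: le_trans (ler_normD _ _) _; rewrite [in X in _ + X]normrM.
  rewrite [X in _ + X * _]ger0_norm; last by [].
  rewrite lerD2r normrM.
  have z0 : 0 <= Z n w / a w n by rewrite divr_ge0// ltW.
  have z1 : Z n w / a w n <= 1 by rewrite ler_pdivrMr ?mul1r.
  rewrite (ger0_norm z0); apply: le_trans (ler_piMl _ z1) _ => //.
  by apply: le_trans (ler_normD _ _) _; rewrite lerD2l ger0_norm// ltW.
have IE : (\int[P]_w (E w)%:E <= (e' / 2 * n.+1%:R + lambda^-1 + n%:R / lambda * (e / 4))%:E)%E.
  rewrite /E; under eq_integral do rewrite EFinD EFinD EFinM.
  rewrite ge0_integralD//; last 4 first.
  - by move=> w _; rewrite -EFinD lee_fin addr_ge0// ltW.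
  - apply/measurable_EFinP/measurable_funD => //; apply: measurableT_comp => //.
    by apply: measurable_funB => //; exact: (ma n).
  - by move=> w _; rewrite -EFinM lee_fin mulr_ge0.
  - by apply/measurable_EFinP/measurable_funM.
  rewrite ge0_integralD//; last 2 first.
  - apply/measurable_EFinP; apply: measurableT_comp => //.
    by apply: measurable_funB => //; exact: (ma n).
  - by move=> w _; rewrite lee_fin ltW.
  rewrite integral_cst// [X in (_ * X)%E](_ : _ = 1%E); last exact: probability_setT.
  rewrite mule1 ge0_integralZl//; [|exact/measurable_EFinP|by move=> w _; rewrite lee_fin].
  rewrite !EFinD [X in (_ <= _ + X)%E]EFinM; apply: leeD; last first.
    apply: lee_wpmul2l; first by rewrite lee_fin.
    by near: n.
  by rewrite leeD2r//; near: n.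
have C0 : (\int[P]_w (gamma * (n%:R / lambda))%:E = (gamma * (n%:R / lambda))%:E)%E.
  rewrite integral_cst// -[RHS]mule1; congr (_ * _)%E; exact: probability_setT.
have g0 : 0 <= gamma * (n%:R / lambda) by rewrite mulr_ge0.
have U : ((\int[P]_w (Z n w)%:E) <= (gamma * (n%:R / lambda))%:E + \int[P]_w (E w)%:E)%E.
  rewrite -C0 -ge0_integralD//; [|by move=> w _; rewrite lee_fin|exact/measurable_EFinP].
  apply: ge0_le_integral => //.
  - by move=> w _; rewrite lee_fin Z_ge0.
  - exact/measurable_EFinP.
  - by apply/measurable_EFinP/measurable_funD.
  - move=> w _; rewrite -EFinD lee_fin -lerBlDl.
    exact: le_trans (ler_norm _) (ZE w).
have V : ((gamma * (n%:R / lambda))%:E <= \int[P]_w (Z n w)%:E + \int[P]_w (E w)%:E)%E.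
  rewrite -C0 -ge0_integralD//; last 4 first.
  - by move=> w _; rewrite lee_fin Z_ge0.
  - exact/measurable_EFinP.
  - by move=> w _; rewrite lee_fin.
  - exact/measurable_EFinP.
  apply: ge0_le_integral => //.
  - by apply/measurable_EFinP/measurable_funD.
  - move=> w _; rewrite -EFinD lee_fin -lerBlDl.
    by apply: le_trans (ler_norm _) _; rewrite distrC.
have IEs := IE.
move: U => /le_trans/(_ (leeD2l _ IE)); move: V => /le_trans/(_ (leeD2l _ IE)).
rewrite meanZ -!EFinD !lee_fin.
move: (\sum_(i < n) prL i.+1) => S V U.
have nbig : 4 / e' * lambda^-1 + 1 <= n%:R by near: n; exact: nbhs_infty_ger.
have e'n : 4 * lambda^-1 + e' <= e' * n%:R.
  by rewrite -ler_pdivrMl// mulrDr mulVf ?gt_eqF// mulrA [_^-1 * 4]mulrC.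
have er : n%:R / lambda * (e / 4) = e' * n%:R by rewrite /e'; field; rewrite gt_eqF.
have Ebound : e' / 2 * n.+1%:R + lambda^-1 + n%:R / lambda * (e / 4) <= 4 * e' * n%:R.
  rewrite er -[n.+1%:R]natr1; lra.
have e4 : 4 * e' * n%:R = lambda^-1 * (e * n%:R) by rewrite /e'; field; rewrite gt_eqF.
rewrite e4 in Ebound.
have U' : lambda^-1 * S <= lambda^-1 * (gamma * n%:R + e * n%:R).
  rewrite mulrDr; apply: le_trans U _.
  by rewrite [lambda^-1 * (gamma * _)]mulrCA [lambda^-1 * n%:R]mulrC lerD2l.
have V' : lambda^-1 * (gamma * n%:R) <= lambda^-1 * (S + e * n%:R).
  rewrite mulrDr [leLHS]mulrCA [lambda^-1 * n%:R]mulrC; apply: le_trans V _.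
  by rewrite lerD2l.
rewrite !ler_pM2l// in U' V'.
rewrite ler_norml; apply/andP; split.
  by rewrite lerBrDr addrC -[_ - e]/(_) lerBlDr ler_pdivrMr// mulrDl.
by rewrite lerBlDr -lerBlDl ler_pdivlMr// mulrBl; lra.
Unshelve. all: end_near.
Qed.

End LostRate.

(** * Balance of orders, windows and losses *)

Section Balance.
Context (R : realType) (d : measure_display) (Omega : measurableType d)
  (P : probability Omega R) (r q : nat) (lambda tau : R)
  (X : nat -> {RV P >-> R}) (s0 : inventory R) (gamma : R).
Hypotheses (q_gt0 : (0 < q)%N) (lambda_gt0 : 0 < lambda) (tau_gt0 : 0 < tau)
  (hX : poisson_interarrivals lambda X) (hs0 : admissible r q tau s0)
  (X_gt0 : forall n w, 0 < X n w)
  (hgamma : long_run_stockout_fraction r q tau s0 X gamma).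

Notation a w := (arrival_epochs X w).
Notation L n := (fun w => lost r q tau s0 (a w) n).
Notation O n := (fun w => ordered r q tau s0 (a w) n).
Notation x := (lambda * tau).
Notation m := ((r + q) %/ q)%N.

Let sL N : R := \sum_(n < N) pr P (L n).
Let sO N : R := \sum_(n < N) pr P (O n).

Let mL n : measurable [set w | L n w].
Proof. exact: measurable_lost. Qed.

Let pO n : past X n.+1 [set w | O n w].
Proof. exact: past_ordered. Qed.

Let mO n : measurable [set w | O n w].
Proof. exact: (past_measurable (@pO n)). Qed.

Let x_ge0 : 0 <= x.
Proof. by rewrite mulr_ge0// ltW. Qed.

Let mltr (f g : Omega -> R) : measurable_fun setT f -> measurable_fun setT g ->
  measurable [set w | f w < g w].
Proof.
by move=> mf mg; rewrite -[X in measurable X]setTI; exact: measurable_fun_ltr.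
Qed.

Let ma n : measurable_fun setT (fun w => a w n).
Proof. by apply: measurable_sum => i; exact: measurable_funPT. Qed.

Let pr_partial_sum n k (t : R) (f : Omega -> bool) : 0 < t -> past X n [set w | f w] ->
  pr P (fun w => f w && (\sum_(j < k) X (n + j)%N w < t)) =
  pr P f * poisson_tail (lambda * t) k.
Proof.
move=> t0 pf; rewrite /pr.
have -> : [set w | f w && (\sum_(j < k) X (n + j)%N w < t)] =
    [set w | f w] `&` [set w | \sum_(j < k) X (n + j)%N w < t].
  by apply/seteqP; split => w /= => [/andP[]|[-> ->]].
rewrite (prob_partial_sum lambda_gt0 hX k t pf) fineM ?fin_num_measure//; last exact: past_measurable pf.
congr (_ * _); rewrite /erlang t0 /poisson_tail /= mulr_sumr mulNr.
by congr (_ - _); apply: eq_bigr => j _; rewrite mulrC.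
Qed.

(** The order at [n] is decided by the past of index [n.+1], and the [k.+1] interarrival times from
    [X n.+1] on are independent of it. *)
Let pr_ordered_arrival n k :
  pr P (fun w => O n w && (a w (n.+1 + k)%N < a w n + tau)) =
  pr P (O n) * poisson_tail x k.+1.
Proof.
rewrite -(pr_partial_sum _ tau_gt0 (@pO n)).
congr (fine (P _)); apply/seteqP; split => w /=;
  by rewrite addSnnS arrival_epochsD ltrD2l.
Qed.

Let pr_arrival_lt j : pr P (fun w => a w j < tau) = poisson_tail x j.+1.
Proof.
have T_ : [set w : Omega | true] = setT by apply/seteqP; split.
have p0 : past X 0 [set w : Omega | true] by rewrite T_; exact: measurableT.
have := pr_partial_sum j.+1 tau_gt0 p0.
rewrite [X in X * _](_ : _ = 1) ?mul1r//.
by rewrite /pr T_ probability_setT.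
Qed.

Let pr_not_lost n : pr P (fun w => ~~ L n w) = 1 - pr P (L n).
Proof.
rewrite /pr (_ : [set w | ~~ L n w] = ~` [set w | L n w]); last first.
  by apply/seteqP; split => w /= /negP.
by rewrite probability_setC// fineB ?fin_num_measure.
Qed.

Let sum_not_lost N : \sum_(n < N) pr P (fun w => ~~ L n w) = N%:R - sL N.
Proof.
under eq_bigr do rewrite pr_not_lost.
by rewrite sumrB sumr_const card_ord.
Qed.

Let mNL n : measurable [set w | ~~ L n w].
Proof.
rewrite (_ : [set w | ~~ L n w] = ~` [set w | L n w]); first exact: measurableC.
by apply/seteqP; split => w /= /negP.
Qed.

Let orders_le N : q%:R * sO N <= (r + q)%:R + (N%:R - sL N).
Proof.
rewrite -sum_not_lost -[X in _ <= _ + X]mul1r.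
apply: (@pr_sum_le _ _ _ P _ _ _ _ (fun i : 'I_N => O i) (fun (i : 'I_N) w => ~~ L i w) q (r + q) 1) => // w.
have := position_sum r q tau s0 (a w) N; have := position_bounds (a w) q_gt0 hs0 N.
rewrite mul1n => /andP[_]; move: (position q (state_after _ _ _ _ _ _)) (position q s0).
move: (\sum_(i < N) ~~ _)%N (q * _)%N => l o p p0; lia.
Qed.

Let orders_ge N : N%:R - sL N <= (r + q)%:R + q%:R * sO N.
Proof.
rewrite -sum_not_lost -[leLHS]mul1r.
apply: (@pr_sum_le _ _ _ P _ _ _ _ (fun (i : 'I_N) w => ~~ L i w) (fun i : 'I_N => O i) 1 (r + q) q) => // w.
have := position_sum r q tau s0 (a w) N; have /andP[_] := hs0.1.
rewrite mul1n; move: (position q (state_after _ _ _ _ _ _)) (position q s0).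
move: (\sum_(i < N) ~~ _)%N (q * _)%N => l o p p0; lia.
Qed.

Let cvg_inv_nat (c : R) : (fun n : nat => c / n%:R) @ \oo --> (0 : R).
Proof.
have C : (fun n : nat => c / n.+1%:R) @ \oo --> (0 : R).
  by rewrite -[X in _ --> X](mulr0 c); apply: cvgMr; exact: cvg_harmonic.
by rewrite -(cvg_shiftS (fun n : nat => c / n%:R)).
Qed.

Let cvg_sL : (fun N => sL N / N%:R) @ \oo --> gamma.
Proof.
have c := cvg_lost_rate q_gt0 lambda_gt0 hX hs0 X_gt0 hgamma.
have := cvgB c (cvg_inv_nat 1) _; have := cvgD c (cvg_inv_nat 1) _.
rewrite addr0 subr0 => cD cB; apply: squeeze_cvgr (cB _) (cD _); near=> n.
rewrite !fctE -mulrBl -mulrDl; set S := \sum_(i < n) _.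
(* The rate already known counts losses from arrival 1 on; the shift of index changes the sum by at
   most one probability. *)
have E : sL n + pr P (L n) = pr P (L 0%N) + S.
  have -> : sL n + pr P (L n) = \sum_(i < n.+1) pr P (L i) by rewrite big_ord_recr.
  by rewrite big_ord_recl.
have := pr_ge0 P (L n); have := pr_ge0 P (L 0%N).
have := pr_le1 P (mL n); have := pr_le1 P (mL 0%N) => *.
by rewrite !ler_wpM2r ?invr_ge0//; lra.
Unshelve. all: end_near.
Qed.

Let cvg_sO : (fun N => q%:R * sO N / N%:R) @ \oo --> 1 - gamma.
Proof.
have c1 : (fun N => (N%:R - sL N) / N%:R) @ \oo --> 1 - gamma.
  apply: (@cvg_trans _ ((fun N => 1 - sL N / N%:R) @ \oo)); last first.
    by apply: cvgB cvg_sL; exact: cvg_cst.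
  apply: near_eq_cvg; near=> n.
  by rewrite /= mulrBl divff// pnatr_eq0 -lt0n; near: n; exact: nbhs_infty_gt.
have := cvgB c1 (cvg_inv_nat (r + q)%:R) _; have := cvgD c1 (cvg_inv_nat (r + q)%:R) _.
rewrite addr0 subr0 => cD cB; apply: squeeze_cvgr (cB _) (cD _); near=> n.
rewrite !fctE -mulrBl -mulrDl; have := orders_le n; have := orders_ge n => *.
by rewrite !ler_wpM2r ?invr_ge0//; lra.
Unshelve. all: end_near.
Qed.

(** The mean excess over [r] of a Poisson demand capped at [K], hence a truncation of [LOSS x r]. *)
Let T K : R := \sum_(r <= k < K) poisson_tail x k.+1.

Let mOA n k : measurable [set w | O n w && (a w (n.+1 + k)%N < a w n + tau)].
Proof.
rewrite (_ : [set w | _] = [set w | O n w] `&` [set w | a w (n.+1 + k)%N < a w n + tau]).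
  by apply: measurableI => //; apply: mltr => //; exact: measurable_funD.
by apply/seteqP; split => w /= => [/andP[]|[-> ->]].
Qed.

(** Pairs of an order and the rank of an arrival after it: the double sum over windows becomes one
    indexed family, as [pr_sum_le] expects. *)
Let windows N K := [seq (n, k) | n <- index_enum 'I_N, k <- index_iota r K].

Let sum_windows N K w :
  (\sum_(z <- windows N K) (O z.1 w && (a w (z.1.+1 + z.2)%N < a w z.1 + tau)%R) =
   \sum_(n < N) O n w * \sum_(r <= k < K) (a w (n.+1 + k)%N < a w n + tau)%R)%N.
Proof.
rewrite big_allpairs; apply: eq_bigr => n _.
by rewrite big_distrr/=; apply: eq_bigr => k _; rewrite mulnb.
Qed.

Let pr_windows N K :
  \sum_(z <- windows N K) pr P (fun w => O z.1 w && (a w (z.1.+1 + z.2)%N < a w z.1 + tau)) =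
  sO N * T K.
Proof.
rewrite big_allpairs mulr_suml; apply: eq_bigr => n _.
by rewrite mulr_sumr; apply: eq_bigr => k _; exact: pr_ordered_arrival.
Qed.

Let windows_lost_le N K : sO N * T K <= m%:R * sL (N + K).
Proof.
rewrite -pr_windows -[leLHS]mul1r -[leRHS]add0r -[0]/(0%:R).
apply: (@pr_sum_le _ _ _ P _ _ _ _ (fun (z : 'I_N * nat) w => O z.1 w && (a w (z.1.+1 + z.2)%N < a w z.1 + tau))
  (fun i : 'I_(N + K) => L i) 1 0 m) => // w.
rewrite mul1n sum_windows; apply: demand_over_orders_le => //.
exact: arrival_epochs_le.
Qed.

(** The sum type merges the arrivals before [tau] and the windows into one family. [LOSS x 0] bounds
    the mean number of those arrivals uniformly in [N]. *)
Let lost_le_windows N : (r < q)%N -> sL N <= LOSS x 0 + sO N * T N.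
Proof.
move=> rq.
pose t := map inl (index_enum 'I_N) ++ map inr (windows N N) : seq ('I_N + 'I_N * nat).
pose G (z : 'I_N + 'I_N * nat) w := match z with
  | inl j => a w j < tau
  | inr z => O z.1 w && (a w (z.1.+1 + z.2)%N < a w z.1 + tau) end.
have mG z : measurable [set w | G z w].
  by case: z => [j|z]; [exact: mltr|exact: mOA].
have : 1%:R * sL N <= 0%:R + 1%:R * \sum_(z <- t) pr P (G z).
  apply: (@pr_sum_le _ _ _ P _ _ _ _ (fun i : 'I_N => L i) G 1 0 1) => // w.
  rewrite !mul1n add0n big_cat !big_map/= sum_windows.
  apply: sum_lost_le => //; exact: arrival_epochs_le.
rewrite !mul1r add0r => /le_trans; apply.
rewrite big_cat !big_map/= lerD// ?pr_windows//.
under eq_bigr do rewrite pr_arrival_lt.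
by rewrite -(big_mkord xpredT (fun j => poisson_tail x j.+1)); exact: sum_poisson_tail_le.
Qed.

(** [N] grows with [K] fixed, which makes the [K] arrivals beyond [N] negligible; only then does [K]
    grow. *)
Let loss_rate_ge : LOSS x r * (1 - gamma) <= q%:R * m%:R * gamma.
Proof.
have TK K : T K * (1 - gamma) <= q%:R * m%:R * gamma.
  have c1 : (fun N => T K * (q%:R * sO N / N%:R)) @ \oo --> T K * (1 - gamma).
    by apply: cvgMr; exact: cvg_sO.
  have c2 : (fun N => q%:R * m%:R * (sL N / N%:R + K%:R / N%:R)) @ \oo --> q%:R * m%:R * gamma.
    by apply: cvgMr; rewrite -[X in _ --> X]addr0; exact: (cvgD cvg_sL (cvg_inv_nat _)).
  apply: (ler_cvg_to c1 c2); near=> N.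
  rewrite -mulrDl !mulrA ler_wpM2r ?invr_ge0//.
  rewrite [T K * _]mulrC -!mulrA ler_wpM2l// [T K * _]mulrC.
  apply: le_trans (windows_lost_le N K) _; rewrite ler_wpM2l//.
  rewrite /sL big_split_ord/= lerD2l.
  rewrite -[K in leRHS]card_ord -sumr_const; apply: ler_sum => i _.
  exact: pr_le1.
have c : (fun K => T K * (1 - gamma)) @ \oo --> LOSS x r * (1 - gamma).
  by apply: cvgMl; exact: cvg_sum_poisson_tail.
by rewrite -(cvg_lim _ c)//; apply: limr_le; [exact: cvgP c|near=> K].
Unshelve. all: end_near.
Qed.

(** Here the truncation may follow [N], since [T N <= LOSS x r] for every [N]. *)
Let loss_rate_le : (r < q)%N -> q%:R * gamma <= LOSS x r * (1 - gamma).
Proof.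
move=> rq.
have c1 : (fun N => q%:R * (sL N / N%:R)) @ \oo --> q%:R * gamma.
  by apply: cvgMr; exact: cvg_sL.
have c2 : (fun N => q%:R * LOSS x 0 / N%:R + LOSS x r * (q%:R * sO N / N%:R)) @ \oo --> LOSS x r * (1 - gamma).
  rewrite -[X in _ --> X]add0r; apply: cvgD => //.
  by apply: cvgMr; exact: cvg_sO.
apply: (ler_cvg_to c1 c2); near=> N.
rewrite !mulrA -mulrDl ler_wpM2r ?invr_ge0//.
rewrite [LOSS x r * q%:R]mulrC -mulrA -mulrDr ler_wpM2l//.
apply: le_trans (lost_le_windows N rq) _; rewrite lerD2l mulrC ler_wpM2r//.
  by apply: sumr_ge0 => i _; exact: pr_ge0.
exact: sum_poisson_tail_le.
Unshelve. all: end_near.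
Qed.

Lemma stockout_fraction_bound :
  let bound := LOSS x r / (LOSS x r + q%:R * m%:R) in
  bound <= gamma /\ ((r < q)%N -> bound = gamma).
Proof.
have L0 := LOSS_ge0 x_ge0 r.
have qm0 : 0 < q%:R * m%:R :> R.
  by rewrite -natrM ltr0n muln_gt0 q_gt0 divn_gt0// leq_addl.
have D0 : 0 < LOSS x r + q%:R * m%:R by rewrite ltr_wpDl.
have ge : LOSS x r / (LOSS x r + q%:R * m%:R) <= gamma.
  rewrite ler_pdivrMr//; have := loss_rate_ge; lra.
split=> // rq; apply/eqP; rewrite eq_le ge /= ler_pdivlMr//.
have -> : m = 1%N by rewrite divnDr// divnn q_gt0 divn_small.
have := loss_rate_le rq; lra.
Qed.

End Balance.

(** * Interarrival times that are positive everywhere *)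

Section PositiveInterarrivals.
Context (R : realType) (d : measure_display) (Omega : measurableType d)
  (P : probability Omega R) (lambda : R) (X : nat -> {RV P >-> R}).
Hypotheses (lambda_gt0 : 0 < lambda) (hX : poisson_interarrivals lambda X).

Let pos (v : R) : R := if 0 < v then v else 1.

Let measurable_pos : measurable_fun setT pos.
Proof. by apply: measurable_fun_ifT => //; exact: measurable_fun_ltr. Qed.

Let measurable_pos_interarrival n : measurable_fun setT (fun w => pos (X n w)).
Proof. exact: measurableT_comp. Qed.

Definition pos_interarrival n : {RV P >-> R} :=
  HB.pack (fun w => pos (X n w))
    (isMeasurableFun.Build _ _ _ _ _ (@measurable_pos_interarrival n)).

Lemma pos_interarrival_gt0 n w : 0 < pos_interarrival n w.
Proof. by rewrite /= /pos; case: ifP. Qed.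

Let prob_interarrival_le0 n : P [set w | X n w <= 0] = 0%E.
Proof.
have := exponential_le0 lambda_gt0 (@lawE R d Omega P lambda X hX n).
by rewrite /distribution /pushforward /= => <-; congr (P _).
Qed.

Let measurable_le0 n : measurable [set w | X n w <= 0].
Proof. by rewrite -[X in measurable X]setTI; exact: measurable_fun_ler. Qed.

Lemma ae_pos_interarrival : {ae P, forall w, forall n, pos_interarrival n w = X n w}.
Proof.
apply: ae_foralln => n; exists [set w | X n w <= 0]; split; [by []|exact: prob_interarrival_le0|].
by move=> w /=; rewrite /pos; case: ifPn => // ; rewrite leNgt.
Qed.

(** Independence survives because one measurable map [pos] is applied to every variable; the laws
    survive because [pos] changes each variable on a null event only. *)
Lemma poisson_pos_interarrival : poisson_interarrivals lambda pos_interarrival.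
Proof.
have mpos (A : set R) : measurable A -> measurable (pos @^-1` A).
  by move=> mA; rewrite -[X in measurable X]setTI; exact: measurable_pos.
split.
  by move=> J A mA; exact: (hX.1 J (fun n => pos @^-1` A n) (fun n => mpos _ (mA n))).
move=> n A mA; rewrite -(hX.2 n A mA) /distribution /pushforward.
have PD (B : set Omega) : measurable B -> P B = P (B `\` [set w | X n w <= 0]).
  move=> mB.
  have B0 : P (B `&` [set w | X n w <= 0]) = 0%E.
    apply/eqP; rewrite -measure_le0 -(prob_interarrival_le0 n).
    apply: le_measure; rewrite ?inE//; exact: measurableI.
  transitivity (P (B `\` [set w | (X n w <= 0)%R]) + P (B `&` [set w | (X n w <= 0)%R]))%E.
    exact: measureDI.
  by rewrite B0 adde0.
have mXA (B : set R) : measurable B -> measurable (X n @^-1` B).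
  by move=> mB; exact: measurable_sfunP.
transitivity (P (X n @^-1` (pos @^-1` A))); first by [].
transitivity (P (X n @^-1` A)); last by [].
rewrite (PD _ (mXA _ (mpos _ mA))) (PD _ (mXA _ mA)); congr (P _).
by apply/seteqP; split => w /= [wA]; rewrite /pos => /negP; rewrite -ltNge => X0;
  split; rewrite ?leNgt ?X0//; move: wA; rewrite /pos X0.
Qed.

End PositiveInterarrivals.

Theorem theorem2 (R : realType) (d : measure_display)
    (Omega : measurableType d) (P : probability Omega R)
    (r q : nat) (lambda tau : R) (X : nat -> {RV P >-> R})
    (s0 : inventory R) (gamma : R)
    (hq : (1 <= q)%N) (hlambda : 0 < lambda) (htau : 0 < tau)
    (hX : poisson_interarrivals lambda X)
    (hs0 : admissible r q tau s0)
    (hgamma : long_run_stockout_fraction r q tau s0 X gamma) :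
  let x := lambda * tau in
  let bound := LOSS x r / (LOSS x r + q%:R * ((r + q) %/ q)%N%:R) in
  bound <= gamma /\ ((r < q)%N -> bound = gamma).
Proof.
apply: (stockout_fraction_bound hq hlambda htau
  (poisson_pos_interarrival hlambda hX) hs0 (@pos_interarrival_gt0 _ _ _ _ X)).
(* Almost surely all interarrival times are unchanged at once, so the epochs and the long run
   fraction are the same. *)
move: (ae_pos_interarrival hlambda hX) hgamma; apply: filterS2 => w wX.
suff -> : arrival_epochs (pos_interarrival X) w = arrival_epochs X w by [].
by apply/funext => n; apply: eq_bigr => i _; exact: wX.
Qed.
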